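(* Let $\phi\in\mathfrak{D}$, $\delta>0$, let $u_1,\dots,u_m$ be weights and let $u=\prod_{i=1}^m u_i^{1/m}$. Then there exists a constant $C$ such that, for all $\vec f=(f_1,\dots,f_m)$, $$\|\mathcal{T}_\phi\vec f\|_{L^{1/m,\infty}(u)}\le C\prod_{i=1}^m\int_{\mathbb{R}^n}|f_i|\,M_{\Phi_1^{1/m},L}\bigl(M_{L(\log L)^\delta}(u_i)\bigr).$$
   Context: Here $n,m\ge1$ are integers; $Q$ denotes a cube in $\mathbb{R}^n$, $l(Q)$ its sidelength, $|Q|$ its Lebesgue measure. A weight is a nonnegative locally integrable function on $\mathbb{R}^n$. The $f_i$ are measurable functions on $\mathbb{R}^n$ for which $\mathcal{T}_\phi\vec f$ is defined. For a weight $w$ and $r>0$, $\|g\|_{L^{r,\infty}(w)}=\sup_{\lambda>0}\lambda\,\bigl(\int_{\{|g|>\lambda\}}w\bigr)^{1/r}$. Condition $\mathfrak{D}$: for $t>0$ let $\mathcal{A}_{(t,\tau,\epsilon)}=\{\vec y=(y_1,\dots,y_m)\in(\mathbb{R}^n)^m:\ \tau(1-\epsilon)t<\sum_{i=1}^m|y_i|\le\tau(1+\epsilon)2t\}$. A nonnegative locally integrable function $\phi$ on $(\mathbb{R}^n)^m$ satisfies $\phi\in\mathfrak{D}$ if there are positive constants $\tau,\epsilon$ (and $C$) with $$\sup_{\vec w\in\mathcal{A}_{(2^k,1,0)}}\phi(\vec w)\le\frac{C}{2^{knm}}\int_{\mathcal{A}_{(2^k,\tau,\epsilon)}}\phi(\vec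 y)\,d\vec y\quad\text{for every }k\in\mathbb{Z}.$$ With these $\tau,\epsilon$, for $t>0$, $$\Phi_1(t)=\sum_{\nu\in\mathbb{Z},\ \nu\ge\log_{1/2}t}\ \int_{\mathcal{A}_{(2^{-\nu},\tau,\epsilon)}}\phi(\vec y)\,d\vec y.$$ Operator: $\mathcal{T}_\phi\vec f(x)=\int_{(\mathbb{R}^n)^m}\phi(x-y_1,\dots,x-y_m)\prod_{i=1}^m f_i(y_i)\,d\vec y$. Averages and maximal operators: for a Young function $\mathcal{B}$, $\|f\|_{\mathcal{B},Q}=\inf\{\lambda>0:\frac1{|Q|}\int_Q\mathcal{B}(|f|/\lambda)\le1\}$. $L(\log L)^\delta$ corresponds to $t(1+\log^+t)^\delta$, and $\|f\|_{L,Q}=\frac1{|Q|}\int_Q|f|$. $M_{L(\log L)^\delta}g(x)=\sup_{Q\ni x}\|g\|_{L(\log L)^\delta,Q}$ and $M_{\Phi_1^{1/m},L}g(x)=\sup_{Q\ni x}\Phi_1(l(Q))^{1/m}\|g\|_{L,Q}$. *)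

(* Defs.v *)
From HB Require Import structures.
From mathcomp Require Import all_boot all_order all_algebra.
From mathcomp Require Import all_classical all_reals all_analysis.

Set Implicit Arguments.
Unset Strict Implicit.
Unset Printing Implicit Defensive.

Import Order.TTheory GRing.Theory Num.Theory.
Import numFieldNormedType.Exports.

Local Open Scope classical_set_scope.
Local Open Scope ring_scope.
Local Open Scope ereal_scope.

(* The library gives [n.-tuple T] the product sigma-algebra but no product
   measure; [tuple_measure mu n] is the n-fold power of a sigma-finite [mu],
   built by iterating the binary product [\x]. *)
Section tuple_measure.
Context d (T : measurableType d) (R : realType).
Variable mu : {sigma_finite_measure set T -> \bar R}.

Definition tuple_pair n (p : T * n.-tuple T) : n.+1.-tuple T :=
  [tuple of p.1 :: p.2].

Lemma measurable_tuple_pair n : measurable_fun setT (@tuple_pair n).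
Proof. exact: (measurable_cons measurable_fst measurable_snd). Qed.

Definition tuple_unpair n (x : n.+1.-tuple T) : T * n.-tuple T :=
  (thead x, [tuple of behead x]).

Lemma tuple_unpairK n : cancel (@tuple_unpair n) (@tuple_pair n).
Proof. by move=> x; rewrite /tuple_pair/= [RHS]tuple_eta. Qed.

Lemma tuple_pairK n : cancel (@tuple_pair n) (@tuple_unpair n).
Proof.
move=> [x y]; rewrite /tuple_unpair /tuple_pair/=; congr (_, _).
exact: val_inj.
Qed.

Lemma measurable_tuple_unpair n : measurable_fun setT (@tuple_unpair n).
Proof.
apply/measurable_fun_pairP; split; first exact: measurable_tnth.
exact: measurable_behead.
Qed.

Section step.
Variables (n : nat) (nu : {sigma_finite_measure set (n.-tuple T) -> \bar R}).

Definition tuple_step : set (n.+1.-tuple T) -> \bar R :=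
  pushforward (mu \x nu) (@tuple_pair n).

Let mpre A : measurable A -> measurable (@tuple_pair n @^-1` A).
Proof.
by move=> mA; rewrite -[X in measurable X]setTI; exact: measurable_tuple_pair.
Qed.

Let tuple_step0 : tuple_step set0 = 0.
Proof. by rewrite /tuple_step /pushforward preimage_set0 measure0. Qed.

Let tuple_step_ge0 A : 0 <= tuple_step A.
Proof. by rewrite /tuple_step /pushforward measure_ge0. Qed.

Let tuple_step_sigma_additive : semi_sigma_additive tuple_step.
Proof.
move=> F mF tF mUF; rewrite /tuple_step /pushforward preimage_bigcup.
apply: measure_semi_sigma_additive; first by move=> k; exact: mpre.
  apply/trivIsetP => /= i j _ _ ij; rewrite -preimage_setI.
  by move/trivIsetP : tF => /(_ _ _ _ _ ij) ->//; rewrite preimage_set0.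
by rewrite -preimage_bigcup; exact: mpre.
Qed.

HB.instance Definition _ := isMeasure.Build _ _ _ tuple_step
  tuple_step0 tuple_step_ge0 tuple_step_sigma_additive.

Lemma tuple_step_sigma_finite : sigma_finite setT tuple_step.
Proof.
have /sigma_finiteP[F [FT ndF Foo]] := sigma_finiteT mu.
have /sigma_finiteP[G [GT ndG Goo]] := sigma_finiteT nu.
exists (fun k => @tuple_unpair n @^-1` (F k `*` G k)).
  rewrite -preimage_bigcup (_ : \bigcup_k _ = setT) ?preimage_setT//.
  rewrite -setXTT FT GT; apply/seteqP; split=> -[x y] /=.
    by move=> [k _ [Fx Gy]]; split; exists k.
  move=> [[k _ Fx] [l _ Gy]]; exists (maxn k l) => //; split.
  - by move: x Fx; exact/subsetPset/ndF/leq_maxl.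
  - by move: y Gy; exact/subsetPset/ndG/leq_maxr.
move=> k; have [mF Fk] := Foo k; have [mG Gk] := Goo k; split.
  rewrite -[X in measurable X]setTI; apply: measurable_tuple_unpair => //.
  exact: measurableX.
rewrite /tuple_step /pushforward (_ : _ @^-1` _ = F k `*` G k).
  by rewrite product_measure1E// lte_mul_pinfty// ge0_fin_numE.
rewrite -comp_preimage (_ : _ \o _ = idfun) ?preimage_id//.
by apply/funext; exact: tuple_pairK.
Qed.

HB.instance Definition _ := Measure_isSigmaFinite.Build _ _ _ tuple_step
  tuple_step_sigma_finite.

End step.

Fixpoint tuple_measure n : {sigma_finite_measure set (n.-tuple T) -> \bar R} :=
  if n is n'.+1 then tuple_step (tuple_measure n') else \d_([tuple]).

Lemma tuple_measure_box n (A : 'I_n -> set T) :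
  (forall i, measurable (A i)) ->
  tuple_measure n [set x | forall i, A i (tnth x i)] = \prod_(i < n) mu (A i).
Proof.
elim: n A => [|n IHn] A mA.
  by rewrite big_ord0 /= diracE mem_set// => -[].
rewrite big_ord_recl -IHn//= /tuple_step /pushforward.
rewrite -product_measure1E//; last first.
  rewrite (_ : mkset _ = \bigcap_(i in [set: 'I_n])
      ((fun x : n.-tuple T => tnth x i) @^-1` A (lift ord0 i))).
    apply: fin_bigcap_measurable => // i _.
    by rewrite -[X in measurable X]setTI; exact: measurable_tnth.
  by apply/seteqP; split=> x /= xA i; [move=> _|]; exact: xA.
congr product_measure1; apply/seteqP; split=> -[x y] /=.
  by move=> xyA; split=> [|i]; [have := xyA ord0|have := xyA (lift ord0 i)];
    rewrite ?tnth0// tnthS.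
move=> [Ax yA] i; case: (unliftP ord0 i) => [j|] ->; rewrite ?tnthS ?tnth0//.
Qed.

End tuple_measure.

Section completion.
Context d (T : measurableType d) (R : realType).
Variable mu : {measure set T -> \bar R}.

Definition completed_measurable (A : set T) :=
  exists2 B, measurable B & mu.-negligible (A `+` B).

(* Measurability of [f] on the completion of [mu].  For such an [f], the library
   integral of [f] against [mu] itself is the integral against the completion:
   it is defined through suprema over simple functions below the positive and
   negative parts, which may be taken Borel. *)
Definition completed_measurable_fun (f : T -> R) :=
  forall Y : set (measurableTypeR R), measurable Y ->
    completed_measurable (f @^-1` Y).

(* [nrm] is meant to be a norm on a finite-dimensional space, whose compact
   subsets are exactly the closed subsets of its (compact) closed balls. *)
Definition loc_integrable (nrm : T -> R) (f : T -> R) :=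
  completed_measurable_fun f /\
  forall r : R, \int[mu]_(x in [set x | (nrm x <= r)%R]) `|f x|%:E < +oo.

End completion.

Notation Rn R n := (n.-tuple (measurableTypeR R)).
Notation Rnm R n m := (m.-tuple (Rn R n)).

Section operators.
Context {R : realType}.
Implicit Types (n m : nat).

Definition leb n : {sigma_finite_measure set (Rn R n) -> \bar R} :=
  tuple_measure (@lebesgue_measure R) n.

Definition lebm n m : {sigma_finite_measure set (Rnm R n m) -> \bar R} :=
  tuple_measure (leb n) m.

Definition enorm n (x : Rn R n) : R :=
  Num.sqrt (\sum_(i < n) tnth x i ^+ 2)%R.

Definition snorm n m (y : Rnm R n m) : R := (\sum_(i < m) enorm (tnth y i))%R.

Definition vsub n (x y : Rn R n) : Rn R n :=
  [tuple (tnth x i - tnth y i)%R | i < n].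

Definition weight n (w : Rn R n -> R) :=
  (forall x, (0 <= w x)%R) /\ loc_integrable (leb n) (@enorm n) w.

Definition annulus n m (t tau eps : R) : set (Rnm R n m) :=
  [set y | (tau * (1 - eps) * t < snorm y)%R /\
           (snorm y <= tau * (1 + eps) * (2 * t))%R].

(* The class D, with its witnesses [tau] and [eps] exposed because [Phi1]
   depends on them. *)
Definition classD n m (tau eps : R) (phi : Rnm R n m -> R) :=
  [/\ forall y, (0 <= phi y)%R,
      loc_integrable (lebm n m) (@snorm n m) phi,
      (0 < tau)%R, (0 < eps)%R &
      exists2 C : R, (0 < C)%R & forall k : int,
        ereal_sup [set (phi w)%:E | w in annulus (2 ^ k)%R 1 0] <=
        (C / 2 ^ (k * (n * m)%N%:Z))%R%:E *
          \int[lebm n m]_(y in annulus (2 ^ k)%R tau eps) (phi y)%:E].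

Definition Phi1 n m (tau eps : R) (phi : Rnm R n m -> R) (t : R) : \bar R :=
  \esum_(nu in [set nu : int | (ln t / ln (2^-1) <= nu%:~R)%R])
    \int[lebm n m]_(y in annulus (2 ^ (- nu))%R tau eps) (phi y)%:E.

Definition multi_kernel n m (phi : Rnm R n m -> R) (f : 'I_m -> Rn R n -> R)
    (x : Rn R n) (y : Rnm R n m) : \bar R :=
  (phi [tuple vsub x (tnth y i) | i < m] * \prod_(i < m) f i (tnth y i))%R%:E.

Definition multi_op n m (phi : Rnm R n m -> R) (f : 'I_m -> Rn R n -> R)
    (x : Rn R n) : \bar R :=
  \int[lebm n m]_y multi_kernel phi f x y.

(* For almost every [x] the integral defining [multi_op phi f x] exists as an
   extended real, that is, is not of the form [+oo - +oo]. *)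
Definition multi_op_defined n m (phi : Rnm R n m -> R)
    (f : 'I_m -> Rn R n -> R) :=
  {ae leb n, forall x,
    (\int[lebm n m]_y (multi_kernel phi f x)^\+ y) +?
    (- \int[lebm n m]_y (multi_kernel phi f x)^\- y)}.

Definition weak_norm n (r : R) (w : Rn R n -> R) (g : Rn R n -> \bar R) :
    \bar R :=
  ereal_sup [set lam%:E *
      (\int[leb n]_(x in [set x | lam%:E < `|g x|]) (w x)%:E) `^ r^-1
    | lam in [set lam : R | (0 < lam)%R]].

(* The closed cube with lower corner [q.1] and sidelength [q.2]. *)
Definition cube n (q : Rn R n * R) : set (Rn R n) :=
  [set x | forall i,
    (tnth q.1 i <= tnth x i)%R /\ (tnth x i <= tnth q.1 i + q.2)%R].

Definition cubes_at n (x : Rn R n) : set (Rn R n * R) :=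
  [set q | (0 < q.2)%R /\ cube q x].

Definition avg n (q : Rn R n * R) (g : Rn R n -> \bar R) : \bar R :=
  ((fine (leb n (cube q)))^-1)%:E * \int[leb n]_(x in cube q) g x.

Definition luxemburg n (B : R -> R) (g : Rn R n -> R) (q : Rn R n * R) :
    \bar R :=
  ereal_inf [set lam%:E | lam in [set lam : R |
    (0 < lam)%R /\ avg q (fun x => (B (`|g x| / lam))%:E) <= 1]].

Definition LlogL (delta t : R) : R := (t * (1 + Num.max 0 (ln t)) `^ delta)%R.

Definition M_LlogL n (delta : R) (g : Rn R n -> R) (x : Rn R n) : \bar R :=
  ereal_sup [set luxemburg (LlogL delta) g q | q in cubes_at x].

Definition M_Phi n m (Phi : R -> \bar R) (g : Rn R n -> \bar R) (x : Rn R n) :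
    \bar R :=
  ereal_sup [set Phi q.2 `^ (m%:R^-1) * avg q (fun z => `|g z|)
    | q in cubes_at x].

End operators.

(* Main.v *)
From HB Require Import structures.
Require Import Defs.
From mathcomp Require Import all_boot all_order all_algebra.
From mathcomp Require Import all_classical all_reals all_analysis.
From mathcomp Require Import measurable_realfun ring lra zify.

Set Implicit Arguments.
Unset Strict Implicit.
Unset Printing Implicit Defensive.

Import Order.TTheory GRing.Theory Num.Theory.
Import numFieldNormedType.Exports.

Local Open Scope classical_set_scope.
Local Open Scope ring_scope.
Local Open Scope ereal_scope.

(** Write [a k] for the mass of [phi] on the annulus of size [2 ^ k] of the class
    D.  Decomposing the kernel along dyadic annuli and using the class D on each
    of them bounds [|T_phi f x|] by a constant times the sum over [k] of [a k]
    times the product over [i] of the means of [|f i|] over the ball of centre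
    [x] and radius [2 ^ (k + 1)] ([kernel_le_dominant]).  Such a ball always lies
    in the cell of [x] of side [2 ^ (k + 4)] of one of [2 ^ n] shifted dyadic
    grids ([third_trick], [grid_cover]), so it suffices to treat, on each grid,
    the dyadic operator S which sums [a k * F k], where [F k] is the product of
    the means of the [f i] over the cell of scale [k].

    Let [b k] be the sum of the [a j] with [j <= k]; it is at most [Phi1] of the
    side of the cell.  Going down from the top scale, select a scale whenever [F]
    exceeds [2 ^ m] times its last selected value.  Between two selected scales
    the [a j] add up, so S is at most [2 ^ m] times the sum of [b k * F k] over
    the selected scales ([sum_le_sum_principal]).  By the arithmetic-geometric
    inequality and the weak type of the dyadic maximal function, the selected
    cells are sparse ([selected_sparse]); hence the part of a cell that carries
    more than L further layers of selected cells has relative measure at most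
    [2 ^ - L] ([layer_count_exp_decay]).

    Sort the selected scales by the size [4 ^ - j] of [b k * F k].  The first
    [2 ^ j] layers of class [j] contribute in all a bounded amount to S
    ([selected_layers]), so they cannot make S large by themselves.  The deeper
    ones live on sets of relative measure at most [2 ^ - (2 ^ j)], and the Luxemburg
    norm of [u i] in L(log L)^delta shows that such sets carry only a fraction of
    order [2 ^ (- j * delta)] of the mass ([integral_thin_le],
    [sum_thinness_le]).  Summing over the layers costs the integral of the
    maximal function of [u i] over the union of the cells ([excess_count_le]),
    and on a cell where [b k * F k > 4 ^ - j] the arithmetic-geometric inequality
    turns that integral into the integral of [f i] against the fractional maximal
    function of the maximal function ([excess_on_selected]).  The sum over [j]
    converges because [delta > 0], which gives [weak_type_normalized]; the
    general case on a grid follows by homogeneity ([grid_weak_type]).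

    All this is done for bounded Borel functions and finitely many scales, with
    constants that do not depend on the bounds; Fatou's lemma then removes the
    truncation. *)

(** * Coarsening partitions *)

Section coarsening_partitions.
Context d (T : measurableType d) (R : realType) (mu : {measure set T -> \bar R}).
Variables (I : countType) (c : nat -> T -> I).
Hypothesis mc : forall k i, measurable (c k @^-1` [set i]).
Hypothesis c_coarse : forall k x y, c k x = c k y -> c k.+1 x = c k.+1 y.

Definition cell k x : set T := [set y | c k y = c k x].

(** Unions of cells of the [k]-th partition: the sets over which an inequality
    may be summed cell by cell. *)
Definition saturated k (G : set T) := forall x y, c k x = c k y -> G x -> G y.

Lemma measurable_cell k x : measurable (cell k x).
Proof. exact: (mc k (c k x)). Qed.

Lemma coarse_leq j k x y : (j <= k)%N -> c j x = c j y -> c k x = c k y.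
Proof.
move=> jk; rewrite -(subnK jk); elim: (k - j)%N => [|i IH]//= /IH.
by rewrite addSn; exact: c_coarse.
Qed.

Lemma saturated_cell k x : saturated k (cell k x).
Proof. by move=> y z yz; rewrite /cell /= yz. Qed.

Lemma saturated_leq j k G : (j <= k)%N -> saturated k G -> saturated j G.
Proof. by move=> jk sG x y /(coarse_leq jk) /sG; exact. Qed.

Let fib k n := [set x | pickle (c k x) = n].

Let mfib k n : measurable (fib k n).
Proof.
case E : (unpickle n : option I) => [i|].
  have [ni|ni] := eqVneq (pickle i) n.
    rewrite (_ : fib k n = c k @^-1` [set i]); first exact: mc.
    by rewrite /fib -ni; apply/seteqP; split=> x /=;
      [exact: (pcan_inj pickleK)|move=> ->].
  rewrite (_ : fib k n = set0)//; apply/seteqP; split=> x //= xn.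
  by move: E ni; rewrite -xn pickleK => -[->]; rewrite eqxx.
rewrite (_ : fib k n = set0)//; apply/seteqP; split=> x //= xn.
by move: E; rewrite -xn pickleK.
Qed.

Let saturated_bigcup k G : G = \bigcup_n (G `&` fib k n).
Proof.
apply/seteqP; split=> [x Gx|x [n _ []//]].
by exists (pickle (c k x)).
Qed.

Let saturated_fib k G n x : saturated k G -> (G `&` fib k n) x ->
  G `&` fib k n = cell k x.
Proof.
move=> sG [Gx xn]; apply/seteqP; split=> y /=.
  by move=> [_ yn]; apply: (pcan_inj pickleK); rewrite [LHS]yn.
by move=> yx; split; [apply: sG Gx|rewrite /fib/= yx].
Qed.

Lemma saturated_measurable k G : saturated k G -> measurable G.
Proof.
move=> sG; rewrite (saturated_bigcup k G); apply: bigcupT_measurable => n.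
have [->//|/set0P[x Gx]] := eqVneq (G `&` fib k n) set0.
by rewrite (saturated_fib sG Gx); exact: measurable_cell.
Qed.

Lemma cellwise_measurable d' (T' : measurableType d') k (g : T -> T') :
  (forall x y, c k x = c k y -> g x = g y) -> measurable_fun setT g.
Proof.
move=> gk _ Y mY; rewrite setTI; apply: (@saturated_measurable k) => x y /gk.
by rewrite /= => ->.
Qed.

(** The cells are countably many and disjoint, so integrals over them add up. *)
Lemma cellwise_le_integral k G (f g : T -> \bar R) : saturated k G ->
  measurable_fun setT f -> measurable_fun setT g ->
  (forall x, 0 <= f x) -> (forall x, 0 <= g x) ->
  (forall x, G x ->
    \int[mu]_(y in cell k x) f y <= \int[mu]_(y in cell k x) g y) ->
  \int[mu]_(y in G) f y <= \int[mu]_(y in G) g y.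
Proof.
move=> sG mf mg f0 g0 fg; rewrite (saturated_bigcup k G).
have mGf n : measurable (G `&` fib k n).
  by apply: measurableI => //; exact: saturated_measurable sG.
have tG : trivIset setT (fun n => G `&` fib k n).
  by move=> i j _ _ [x [[_ <-] [_ <-]]].
rewrite !ge0_integral_bigcup//; try exact: measurable_funTS.
apply: lee_nneseries => n _; first by move=> _; exact: integral_ge0.
have [->|/set0P[x Gx]] := eqVneq (G `&` fib k n) set0.
  by rewrite !integral_set0.
by rewrite (saturated_fib sG Gx); apply: fg; case: Gx.
Qed.

End coarsening_partitions.

(** * Counting the layers of a sparse family of cells *)

Lemma integral_setI_bool d (T : measurableType d) (R : realType)
    (mu : {measure set T -> \bar R}) (D : set T) (b : pred T) (f : T -> \bar R) :
  \int[mu]_(x in D `&` [set y | b y]) f x =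
  \int[mu]_(x in D) ((b x)%:R%:E * f x).
Proof.
rewrite integral_mkcondr; apply: eq_integral => y _; rewrite /patch.
by case: ifPn; [rewrite inE/= => ->; rewrite mulr1n mul1e|
  rewrite notin_setE/= => /negP/negbTE ->; rewrite mulr0n mul0e].
Qed.

Section sparse_counting.
Context d (T : measurableType d) (R : realType) (mu : {measure set T -> \bar R}).
Variables (I : countType) (c : nat -> T -> I) (s : nat -> R).
Hypothesis mc : forall k i, measurable (c k @^-1` [set i]).
Hypothesis c_coarse : forall k x y, c k x = c k y -> c k.+1 x = c k.+1 y.
Hypothesis s_gt0 : forall k, (0 < s k)%R.
Hypothesis mu_cell : forall k x, mu (cell c k x) = (s k)%:E.

Variable p : nat -> T -> bool.
Hypothesis p_cell : forall k x y, c k x = c k y -> p k x = p k y.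

Definition layer_count k x := (\sum_(j < k) p j x)%N.

Lemma layer_countS k x : layer_count k.+1 x = (layer_count k x + p k x)%N.
Proof. by rewrite /layer_count big_ord_recr. Qed.

Lemma layer_count_cell k x y : c 0%N x = c 0%N y -> layer_count k x = layer_count k y.
Proof.
by move=> xy; apply: eq_bigr => j _; rewrite (p_cell (coarse_leq c_coarse (leq0n j) xy)).
Qed.

Let mfun0 d' (T' : measurableType d') (g : T -> T') :
  (forall x y, c 0%N x = c 0%N y -> g x = g y) -> measurable_fun setT g.
Proof. exact: (cellwise_measurable mc). Qed.

Let mset0 (E : pred T) :
  (forall x y, c 0%N x = c 0%N y -> E x = E y) -> measurable [set x | E x].
Proof.
move=> E0; apply: (@saturated_measurable _ _ _ c mc 0%N) => x y /E0 /=.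
by move=> ->.
Qed.

Let mcount k (E : pred nat) : measurable [set x | E (layer_count k x)].
Proof. by apply: mset0 => x y /(layer_count_cell k) ->. Qed.

Hypothesis sparse : forall k x, p k x ->
  mu (cell c k x `&` [set y | (0 < layer_count k y)%N]) <= (2^-1)%:E * mu (cell c k x).

Lemma sparse_saturated k G : saturated c k G -> (forall x, G x -> p k x) ->
  mu (G `&` [set y | (0 < layer_count k y)%N]) <= (2^-1)%:E * mu G.
Proof.
move=> sG Gp; have mG := saturated_measurable mc sG.
rewrite setIC -integral_indic//.
rewrite -integral_cst//; apply: (cellwise_le_integral mc sG) => //.
- apply/measurable_EFinP/measurable_indic; exact: (mcount k (fun n => (0 < n)%N)).
- by move=> x /=; rewrite lee_fin.
move=> x /Gp pk; have mC := measurable_cell mc k x.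
rewrite integral_indic//.
by rewrite integral_cst// setIC sparse.
Qed.

Lemma layer_count_exp_decay k G L : saturated c k G ->
  mu (G `&` [set y | (L < layer_count k y)%N]) <=
  (2^-1 ^+ L)%:E * mu (G `&` [set y | (0 < layer_count k y)%N]).
Proof.
elim: k G L => [|k IH] G L sG.
  rewrite (_ : _ `&` _ = set0) ?measure0; last first.
    by rewrite -subset0 => x [_] /=; rewrite /layer_count big_ord0.
  by rewrite mule_ge0// lee_fin exprn_ge0.
case: L => [|L]; first by rewrite expr0 mul1e.
have {}sG := saturated_leq c_coarse (leqnSn k) sG.
have mG := saturated_measurable mc sG.
pose P := [set x | p k x].
have mP : measurable P.
  by apply: (@saturated_measurable _ _ _ c mc k) => x y /p_cell xy; rewrite /P /= xy.
have sGP : saturated c k (G `&` P).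
  by move=> x y xy [Gx]; rewrite /P/= (p_cell xy); split=> //; exact: sG Gx.
have sGN : saturated c k (G `&` ~` P).
  by move=> x y xy [Gx]; rewrite /P/= (p_cell xy); split=> //; exact: sG Gx.
have mS j E : measurable [set x | (E < layer_count j x)%N].
  exact: (mcount j (fun n => (E < n)%N)).
rewrite (_ : G `&` _ = (G `&` P `&` [set y | (L < layer_count k y)%N]) `|`
    (G `&` ~` P `&` [set y | (L.+1 < layer_count k y)%N])); last first.
  apply/seteqP; split=> x; rewrite /P/= layer_countS.
    by move=> [Gx]; case: (p k x); rewrite ?addn1 ?addn0 => h; [left|right].
  by move=> [[[Gx pk] h]|[[Gx /negP/negbTE pk] h]]; rewrite pk ?addn1 ?addn0.
rewrite (_ : G `&` [set y | (0 < layer_count k.+1 y)%N] = (G `&` P) `|`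
    (G `&` ~` P `&` [set y | (0 < layer_count k y)%N])); last first.
  apply/seteqP; split=> x; rewrite /P/= layer_countS.
    by move=> [Gx]; case: (p k x); rewrite ?addn1 ?addn0 => h; [left|right].
  by move=> [[Gx ->]|[[Gx /negP/negbTE pk] h]]; rewrite ?pk ?addn1 ?addn0.
have mGP : measurable (G `&` P) by exact: measurableI.
have mGN : measurable (G `&` ~` P) by apply: measurableI => //; exact: measurableC.
apply: (le_trans (measureU2 _ _ _)); try exact: measurableI.
rewrite [X in _ <= _ * X]measureU//; last 2 first.
- exact: measurableI.
- by rewrite -subset0 => x [[_ Px] [[_ nPx] _]].
rewrite muleDr ?ge0_adde_def ?inE//; apply: leeD; last exact: IH.
apply: (le_trans (IH _ _ sGP)); rewrite exprSr EFinM -muleA.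
apply: lee_wpmul2l; first by rewrite lee_fin exprn_ge0.
by apply: sparse_saturated => // x [].
Qed.

Section one_weight.
Variables (u : T -> R) (v : T -> \bar R) (nu : nat -> T -> \bar R).
Variables (L : nat) (tau : R).
Hypothesis u_meas : measurable_fun setT u.
Hypothesis u_ge0 : forall x, (0 <= u x)%R.
Hypothesis mv : measurable_fun setT v.
Hypothesis tau_ge0 : (0 <= tau)%R.
Hypothesis nu_ge0 : forall k x, 0 <= nu k x.
Hypothesis nu_v : forall k x y, c k x = c k y -> nu k x <= v y.
Hypothesis thin : forall k x E, measurable E ->
  mu (cell c k x `&` E) <= (2^-1 ^+ L)%:E * mu (cell c k x) ->
  \int[mu]_(y in cell c k x `&` E) (u y)%:E <= tau%:E * mu (cell c k x) * nu k x.

Let v_ge0 x : 0 <= v x.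
Proof. exact: le_trans (nu_ge0 0%N x) (nu_v _). Qed.

Let mEu : measurable_fun setT (fun x => (u x)%:E).
Proof. exact/measurable_EFinP. Qed.

Let mcnt (E : nat -> nat) k :
  measurable_fun setT (fun y => (E (layer_count k y))%:R%:E : \bar R).
Proof. by apply: mfun0 => y z yz; rewrite (layer_count_cell k yz). Qed.

(** By [layer_count_exp_decay] the part of the cell below [L] layers is thin
    enough for the hypothesis [thin]; by sparsity at least half of the cell is
    not covered by deeper cells, and [v >= nu] there, whence the factor 2. *)
Lemma deep_part_le k x : p k x ->
  \int[mu]_(y in cell c k x) ((L <= layer_count k y)%N%:R%:E * (u y)%:E) <=
  (2 * tau)%:E * \int[mu]_(y in cell c k x) ((layer_count k y == 0)%N%:R%:E * v y).
Proof.
move=> pk; have mC := measurable_cell mc k x.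
have mL : measurable [set y | (L <= layer_count k y)%N].
  exact: (mcount k (fun n => (L <= n)%N)).
have m0 : measurable [set y | (layer_count k y == 0)%N].
  exact: (mcount k (fun n => (n == 0)%N)).
have -> : \int[mu]_(y in cell c k x) ((L <= layer_count k y)%N%:R%:E * (u y)%:E) =
    \int[mu]_(y in cell c k x `&` [set y | (L <= layer_count k y)%N]) (u y)%:E.
  by rewrite integral_setI_bool.
apply: (@le_trans _ _ (tau%:E * mu (cell c k x) * nu k x)).
  apply: thin => //.
  case: (posnP L) => [->|L0].
    rewrite expr0 mul1e; apply: le_measure; rewrite ?inE//; exact: measurableI.
  have := layer_count_exp_decay L.-1 (saturated_cell (k := k) (x := x)).
  rewrite prednK// => /le_trans; apply.
  have -> : (2^-1 ^+ L = 2^-1 ^+ L.-1 * 2^-1 :> R)%R by rewrite -exprSr prednK.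
  rewrite EFinM -muleA; apply: lee_wpmul2l; first by rewrite lee_fin exprn_ge0.
  exact: sparse.
have half : (2^-1 * s k)%:E <= mu (cell c k x `&` [set y | layer_count k y == 0%N]).
  have := sparse pk; have := mu_cell k x.
  rewrite (_ : mu (cell c k x) = mu (cell c k x `&` [set y | (0 < layer_count k y)%N]) +
     mu (cell c k x `&` [set y | layer_count k y == 0%N])); last first.
    rewrite -measureU//.
    - by congr (mu _); apply/seteqP; split=> y /=; [|by move=> [[]|[]]];
        case: posnP => ?; [right|left].
    - by apply: measurableI => //; exact: (mcount k (fun n => (0 < n)%N)).
    - exact: measurableI.
    - rewrite -subset0 => y [[_ /= h] [_ /= /eqP e]].
      by move: h; rewrite e.
  move: (mu _) (mu _) => [a| |] [b| |]//=.
  by rewrite -!EFinD -EFinM !lee_fin => -[<-] ?; lra.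
apply: (@le_trans _ _ ((2 * tau)%:E * (nu k x *
    mu (cell c k x `&` [set y | layer_count k y == 0%N])))).
  rewrite mu_cell muleC -!EFinM [X in _ <= X]muleCA.
  apply: lee_wpmul2l => //.
  apply: (@le_trans _ _ ((2 * tau)%:E * (2^-1 * s k)%:E)).
    by rewrite -EFinM (_ : 2 * tau * (2^-1 * s k) = tau * s k)%R//; field.
  by apply: lee_wpmul2l => //; rewrite lee_fin mulr_ge0.
apply: lee_wpmul2l; first by rewrite lee_fin mulr_ge0.
rewrite -integral_cst//; last exact: measurableI.
rewrite integral_setI_bool; apply: ge0_le_integral => //.
- by move=> y _ /=; rewrite mule_ge0 ?lee_fin.
- by apply/measurable_funTS/emeasurable_funM => //; exact: (mcnt (fun n => n == 0)%N k).
- by apply/measurable_funTS/emeasurable_funM => //; exact: (mcnt (fun n => n == 0)%N k).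
move=> y xy; apply: lee_wpmul2l; rewrite ?lee_fin//.
by apply: nu_v; rewrite xy.
Qed.

Let mw (E : nat -> nat) k :
  measurable_fun setT (fun y => (E (layer_count k y))%:R%:E * (u y)%:E).
Proof. by apply: emeasurable_funM => //; exact: mcnt. Qed.

Let mwv (E : nat -> nat) k :
  measurable_fun setT (fun y => (E (layer_count k y))%:R%:E * v y).
Proof. by apply: emeasurable_funM => //; exact: mcnt. Qed.

Let mpw (E : nat -> nat) k (g : T -> \bar R) : measurable_fun setT g ->
  measurable_fun setT (fun y => (p k y * E (layer_count k y))%N%:R%:E * g y).
Proof.
move=> mg; apply: emeasurable_funM => //.
apply: (mfun0 (g := fun y => (p k y * E (layer_count k y))%N%:R%:E)) => y z yz.
by rewrite (layer_count_cell k yz) (p_cell (coarse_leq c_coarse (leq0n k) yz)).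
Qed.

(** Passing from [k] to [k + 1] adds to the excess the set of points of a new
    cell having at least [L] layers below, and adds to the covered region the
    points of that cell not covered before: [deep_part_le] compares the two. *)
Lemma excess_count_step k G : saturated c k G ->
  \int[mu]_(y in G) ((layer_count k y - L)%N%:R%:E * (u y)%:E) <=
    (2 * tau)%:E * \int[mu]_(y in G) ((0 < layer_count k y)%N%:R%:E * v y) ->
  \int[mu]_(y in G) ((layer_count k.+1 y - L)%N%:R%:E * (u y)%:E) <=
    (2 * tau)%:E * \int[mu]_(y in G) ((0 < layer_count k.+1 y)%N%:R%:E * v y).
Proof.
move=> sG IH; have mG := saturated_measurable mc sG.
have -> : \int[mu]_(y in G) ((layer_count k.+1 y - L)%N%:R%:E * (u y)%:E) =
    \int[mu]_(y in G) ((layer_count k y - L)%N%:R%:E * (u y)%:E) +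
    \int[mu]_(y in G) ((p k y * (L <= layer_count k y))%N%:R%:E * (u y)%:E).
  rewrite -ge0_integralD//.
  - apply: eq_integral => y _; rewrite -ge0_muleDl ?lee_fin// -EFinD -natrD.
    congr ((_%:R)%:E * _); rewrite layer_countS; case: (p k y) => /=; rewrite ?mul1n ?mul0n; lia.
  - by move=> y _; rewrite mule_ge0 ?lee_fin.
  - exact: measurable_funTS (mw (fun n => n - L)%N k).
  - by move=> y _; rewrite mule_ge0 ?lee_fin.
  - exact: measurable_funTS (mpw (fun n => L <= n)%N k mEu).
have -> : \int[mu]_(y in G) ((0 < layer_count k.+1 y)%N%:R%:E * v y) =
    \int[mu]_(y in G) ((0 < layer_count k y)%N%:R%:E * v y) +
    \int[mu]_(y in G) ((p k y * (layer_count k y == 0))%N%:R%:E * v y).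
  rewrite -ge0_integralD//.
  - apply: eq_integral => y _; rewrite -ge0_muleDl ?lee_fin// -EFinD -natrD.
    by congr ((_%:R)%:E * _); rewrite layer_countS; case: (p k y) => /=; case: (layer_count k y).
  - by move=> y _; rewrite mule_ge0 ?lee_fin.
  - exact: measurable_funTS (mwv (fun n => 0 < n)%N k).
  - by move=> y _; rewrite mule_ge0 ?lee_fin.
  - exact: measurable_funTS (mpw (fun n => n == 0)%N k mv).
rewrite muleDr ?ge0_adde_def ?inE ?integral_ge0//; last 2 first.
- by move=> y _; rewrite mule_ge0 ?lee_fin.
- by move=> y _; rewrite mule_ge0 ?lee_fin.
apply: leeD => //.
have t0 : (0 <= 2 * tau)%R by rewrite mulr_ge0.
rewrite -ge0_integralZl//; last 2 first.
- exact: measurable_funTS (mpw (fun n => n == 0)%N k mv).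
- by move=> y _; rewrite mule_ge0 ?lee_fin.
apply: (cellwise_le_integral mc sG) => //.
- exact: (mpw (fun n => L <= n)%N k mEu).
- by apply: measurable_funeM; exact: (mpw (fun n => n == 0)%N k mv).
- by move=> y; rewrite mule_ge0 ?lee_fin.
- by move=> y; rewrite mule_ge0 ?lee_fin ?mule_ge0 ?lee_fin.
move=> x _; have mC := measurable_cell mc k x.
rewrite ge0_integralZl//; last 2 first.
- exact: measurable_funTS (mpw (fun n => n == 0)%N k mv).
- by move=> y _; rewrite mule_ge0 ?lee_fin.
have [pk|/negbTE pk] := boolP (p k x).
  have := deep_part_le pk.
  have e (E : nat -> nat) (g : T -> \bar R) :
      \int[mu]_(y in cell c k x) ((p k y * E (layer_count k y))%N%:R%:E * g y) =
      \int[mu]_(y in cell c k x) ((E (layer_count k y))%:R%:E * g y).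
    apply: eq_integral => y; rewrite inE => yx.
    by rewrite (p_cell yx) pk mul1n.
  by rewrite (e (fun n => L <= n)%N) (e (fun n => n == 0)%N).
rewrite integral0_eq.
  by rewrite mule_ge0 ?lee_fin ?integral_ge0// => y _; rewrite mule_ge0 ?lee_fin.
by move=> y yx; rewrite (p_cell yx) pk mul0n mulr0n mul0e.
Qed.

(** The sets where a cell of the family is the smallest one are disjoint, which
    is why the right-hand side is a single integral although the left-hand side
    sums over all layers beyond the [L]-th. *)
Lemma excess_count_le k G : saturated c k G ->
  \int[mu]_(y in G) ((layer_count k y - L)%N%:R%:E * (u y)%:E) <=
    (2 * tau)%:E * \int[mu]_(y in G) ((0 < layer_count k y)%N%:R%:E * v y).
Proof.
elim: k G => [|k IH] G sG.
  rewrite integral0_eq.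
    rewrite mule_ge0 ?lee_fin ?mulr_ge0 ?integral_ge0// => y _.
    by rewrite mule_ge0 ?lee_fin.
  by move=> y _; rewrite /layer_count big_ord0 sub0n mulr0n mul0e.
have {}sG := saturated_leq c_coarse (leqnSn k) sG.
exact/excess_count_step/IH.
Qed.

End one_weight.
End sparse_counting.

(** * Greedy selection of scales *)

Section stopping_scales.
Context {T : Type} {R : realType}.
Variables (F : nat -> T -> R) (K : nat) (A : R).
Hypothesis A_ge1 : (1 <= A)%R.
Hypothesis F_ge0 : forall k x, (0 <= F k x)%R.

(** Value of [F] at the last scale selected among [K], [K - 1], ..., [K - d]: a
    scale is selected when [F] has grown by more than the factor [A]. *)
Fixpoint stopped_value_from d x : R :=
  if d is d'.+1 then
    let r := stopped_value_from d' x in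
    if (A * r < F (K - d) x)%R then F (K - d) x else r
  else F K x.

Definition stopped_value k x := stopped_value_from (K - k) x.

Definition principal k x :=
  (k <= K)%N && ((k == K) || (A * stopped_value k.+1 x < F k x)%R).

Lemma stopped_value_top x : stopped_value K x = F K x.
Proof. by rewrite /stopped_value subnn. Qed.

Lemma stopped_valueE k x : (k < K)%N -> stopped_value k x =
  if (A * stopped_value k.+1 x < F k x)%R then F k x else stopped_value k.+1 x.
Proof.
move=> kK; rewrite /stopped_value -(subnSK kK) /=.
by rewrite (_ : (K - (K - k.+1).+1) = k)%N//; lia.
Qed.

Lemma stopped_value_ge0 k x : (0 <= stopped_value k x)%R.
Proof.
by rewrite /stopped_value; elim: (K - k)%N => //= d IH; case: ifP.
Qed.

Lemma stopped_value_step k x : (k < K)%N ->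
  (stopped_value k.+1 x <= stopped_value k x)%R.
Proof.
move=> kK; rewrite (stopped_valueE x kK); case: ifPn => // /ltW.
by apply: le_trans; rewrite ler_peMl ?stopped_value_ge0.
Qed.

Lemma stopped_value_anti j k x : (j <= k <= K)%N ->
  (stopped_value k x <= stopped_value j x)%R.
Proof.
move=> /andP[jk]; rewrite -(subnK jk); elim: (k - j)%N => [//|i IH].
by rewrite addSn => iK; apply: le_trans (IH (ltnW iK)); exact: stopped_value_step.
Qed.

Lemma principal_stopped k x : principal k x -> stopped_value k x = F k x.
Proof.
move=> /andP[kK]; have [->|nk] /= := eqVneq k K; first by rewrite stopped_value_top.
by move=> h; rewrite stopped_valueE ?h// ltn_neqAle nk.
Qed.

Lemma le_stopped_value k x : (k <= K)%N -> (F k x <= A * stopped_value k x)%R.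
Proof.
rewrite leq_eqVlt => /predU1P[->|kK].
  by rewrite stopped_value_top ler_peMl.
rewrite stopped_valueE//; case: ifPn => [_|]; first by rewrite ler_peMl.
by rewrite -leNgt.
Qed.

(** A selected scale exceeds by the factor [A] every value selected above it; this
    is what makes the selected cells sparse. *)
Lemma principal_below j k x : (j < k <= K)%N -> principal j x ->
  (A * stopped_value k x < F j x)%R.
Proof.
move=> /andP[jk kK] /andP[_ /orP[/eqP jK|]].
  by move: (leq_trans jk kK); rewrite jK ltnn.
apply: le_lt_trans; rewrite ler_pM2l ?(lt_le_trans _ A_ge1)//.
by apply: stopped_value_anti; rewrite jk.
Qed.

(** Summation by parts: [stopped_value] is constant between selected scales, so
    only the partial sums of [a] at the selected scales enter. *)
Lemma sum_stopped_value_le (a : nat -> R) k x : (forall j, (0 <= a j)%R) ->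
  (k <= K)%N ->
  (\sum_(j < k.+1) a j * stopped_value j x <=
   (\sum_(j < k.+1) a j) * stopped_value k x +
   \sum_(j < k) (principal j x)%:R * ((\sum_(i < j.+1) a i) * F j x))%R.
Proof.
move=> a0; elim: k => [_|k IH kK]; first by rewrite !big_ord_recl !big_ord0 !addr0.
rewrite big_ord_recr/=; have {}IH := IH (ltnW kK).
apply: (le_trans (lerD IH (lexx _))).
rewrite [X in (_ <= X * _ + _)%R]big_ord_recr/= [X in (_ <= _ + X)%R]big_ord_recr/=.
rewrite mulrDl -addrA addrAC [X in (_ <= X)%R]addrAC.
set X := (\sum_(i < k) _)%R; set b := (\sum_(i < k.+1) _)%R.
have b0 : (0 <= b)%R by exact: sumr_ge0.
have : (b * stopped_value k x <= b * stopped_value k.+1 x +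
    (principal k x)%:R * (b * F k x))%R.
  rewrite /principal (ltnW kK) (ltn_eqF kK) /= stopped_valueE//.
  case: ifPn => _ /=; last by rewrite mulr0n mul0r addr0.
  by rewrite mulr1n mul1r lerDr mulr_ge0// stopped_value_ge0.
by lra.
Qed.

Lemma sum_le_sum_principal (a : nat -> R) x : (forall j, (0 <= a j)%R) ->
  (\sum_(j < K.+1) a j * F j x <=
   A * \sum_(j < K.+1) (principal j x)%:R * ((\sum_(i < j.+1) a i) * F j x))%R.
Proof.
move=> a0.
apply: (@le_trans _ _ (A * \sum_(j < K.+1) a j * stopped_value j x))%R.
  rewrite mulr_sumr; apply: ler_sum => j _; rewrite mulrCA ler_wpM2l//.
  by apply: le_stopped_value; rewrite -ltnS.
rewrite ler_pM2l ?(lt_le_trans _ A_ge1)//.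
apply: (le_trans (sum_stopped_value_le _ a0 (leqnn K))).
rewrite [leRHS]big_ord_recr/= [leLHS]addrC lerD2l.
by rewrite {1}/principal leqnn eqxx /= mulr1n mul1r stopped_value_top.
Qed.

End stopping_scales.

(** A number of the unit interval is recovered, up to the constant built into the
    geometric series, from the dyadic thresholds that it passes. *)
Lemma dyadic_layers (R : realFieldType) (J : nat) (t : R) : (0 <= t <= 1)%R ->
  (t <= \sum_(j < J) 4^-1 ^+ j * (4^-1 ^+ j.+1 < t)%R%:R + 4^-1 ^+ J)%R.
Proof.
move=> /andP[t0 t1]; elim: J => [|J IH]; first by rewrite big_ord0 add0r expr0.
have e n : (0 <= 4^-1 ^+ n :> R)%R by rewrite exprn_ge0.
have S0 : (0 <= \sum_(j < J) 4^-1 ^+ j * (4^-1 ^+ j.+1 < t)%R%:R :> R)%R.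
  by apply: sumr_ge0 => j _; rewrite mulr_ge0.
rewrite big_ord_recr/=; case: ltP => h; rewrite ?mulr1n ?mulr0n ?mulr1 ?mulr0 ?addr0.
  by apply: (le_trans IH); rewrite lerDl.
by apply: (le_trans h); rewrite lerDr.
Qed.

Lemma prod_le_mean_exp (R : realFieldType) (m : nat) (E : 'I_m -> R) :
  (forall i, 0 <= E i)%R ->
  (\prod_(i < m) E i <= (m%:R^-1 * \sum_(i < m) E i) ^+ m)%R.
Proof.
move=> E0; have [+ _] := leif_AGM (A := 'I_m) (fun i _ => E0 i).
by rewrite card_ord mulrC.
Qed.

(** * The dyadic maximal function and the sparsity of the selected scales *)

Section dyadic_maximal.
Context d (T : measurableType d) (R : realType) (mu : {measure set T -> \bar R}).
Variables (I : countType) (c : nat -> T -> I) (s : nat -> R).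
Hypothesis mc : forall k i, measurable (c k @^-1` [set i]).
Hypothesis c_coarse : forall k x y, c k x = c k y -> c k.+1 x = c k.+1 y.
Hypothesis mu_cell : forall k x, mu (cell c k x) = (s k)%:E.

Lemma cell_eq k x y : c k x = c k y -> cell c k x = cell c k y.
Proof. by move=> xy; rewrite /cell xy. Qed.

(** The maximal cells on which the mean of [h] exceeds [alpha] are disjoint; the
    induction on [k] replaces their choice. *)
Lemma dyadic_maximal_weak (h : T -> \bar R) (alpha : R) k G :
  measurable_fun setT h -> (forall x, 0 <= h x) -> (0 <= alpha)%R ->
  saturated c k G ->
  alpha%:E * mu (G `&` [set y | [exists j : 'I_k,
    alpha%:E * (s j)%:E < \int[mu]_(z in cell c j y) h z]]) <=
  \int[mu]_(y in G) h y.
Proof.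
move=> mh h0 al0; elim: k G => [|k IH] G sG.
  rewrite (_ : _ `&` _ = set0) ?measure0 ?mule0 ?integral_ge0//.
  by rewrite -subset0 => x [_ /= /existsP[[]]].
have {}sG := saturated_leq c_coarse (leqnSn k) sG.
have mG := saturated_measurable mc sG.
pose big j y := alpha%:E * (s j)%:E < \int[mu]_(z in cell c j y) h z.
have bigE j x y : c j x = c j y -> big j x = big j y.
  by move=> xy; rewrite /big (cell_eq xy).
have mB j : measurable [set y | [exists i : 'I_j, big i y]].
  apply: (@saturated_measurable _ _ _ c mc 0%N) => x y xy /= /existsP[i bi].
  by apply/existsP; exists i; rewrite -(bigE _ _ _ (coarse_leq c_coarse (leq0n i) xy)).
pose P := [set x | big k x].
have sGP : saturated c k (G `&` P).
  by move=> x y xy [Gx]; rewrite /P/= (bigE _ _ _ xy); split=> //; exact: sG Gx.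
have sGN : saturated c k (G `&` ~` P).
  by move=> x y xy [Gx]; rewrite /P/= (bigE _ _ _ xy); split=> //; exact: sG Gx.
have mGP := saturated_measurable mc sGP.
have mGN := saturated_measurable mc sGN.
have -> : G = (G `&` P) `|` (G `&` ~` P) by rewrite -setIUr setUv setIT.
rewrite ge0_integral_setU//; last 2 first.
- exact: measurable_funTS.
- by apply/disj_setPS => x [[_ Px] [_ nPx]].
apply: (@le_trans _ _ (alpha%:E * (mu (G `&` P) +
    mu (G `&` ~` P `&` [set y | [exists i : 'I_k, big i y]])))).
  apply: lee_wpmul2l; rewrite ?lee_fin//.
  apply: (@le_trans _ _ (mu ((G `&` P) `|`
      (G `&` ~` P `&` [set y | [exists i : 'I_k, big i y]])))); last first.
    by apply: measureU2 => //; exact: measurableI.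
  apply: le_measure; rewrite ?inE.
  - by apply: measurableI => //; exact: measurableU.
  - by apply: measurableU => //; exact: measurableI.
  move=> x [[//|]]; first by left.
  move=> [Gx nPx] /existsP[i]; rewrite -/(big i x) => bi; right; split=> //=.
  have /predU1P[ik|ik] : (i == k :> nat) || (i < k)%N by rewrite -leq_eqVlt -ltnS.
    by case: nPx; rewrite /P/= -ik.
  by apply/existsP; exists (Ordinal ik).
rewrite muleDr ?ge0_adde_def ?inE//; apply: leeD; last exact: IH.
rewrite -integral_cst//; apply: (cellwise_le_integral mc sGP) => //.
move=> x [_ Px]; rewrite integral_cst ?mu_cell; last exact: measurable_cell.
exact: ltW.
Qed.

End dyadic_maximal.

Section multilinear_sparse.
Context d (T : measurableType d) (R : realType) (mu : {measure set T -> \bar R}).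
Variables (I : countType) (c : nat -> T -> I) (s : nat -> R).
Hypothesis mc : forall k i, measurable (c k @^-1` [set i]).
Hypothesis c_coarse : forall k x y, c k x = c k y -> c k.+1 x = c k.+1 y.
Hypothesis s_gt0 : forall k, (0 < s k)%R.
Hypothesis mu_cell : forall k x, mu (cell c k x) = (s k)%:E.

Variables (m : nat) (f : 'I_m -> T -> R).
Hypothesis m_gt0 : (0 < m)%N.
Hypothesis mf : forall i, measurable_fun setT (f i).
Hypothesis f_ge0 : forall i x, (0 <= f i x)%R.
Hypothesis f_fin : forall i k x, \int[mu]_(y in cell c k x) (f i y)%:E < +oo.

Definition mean i k x : R := (fine (\int[mu]_(y in cell c k x) (f i y)%:E) / s k)%R.

Definition prod_mean k x : R := (\prod_(i < m) mean i k x)%R.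

Let f0 i x : 0 <= (f i x)%:E. Proof. by rewrite lee_fin. Qed.

Let mEf i D : measurable_fun D (fun x => (f i x)%:E).
Proof. exact/measurable_funTS/measurable_EFinP. Qed.

Lemma meanE i k x : \int[mu]_(y in cell c k x) (f i y)%:E = (mean i k x * s k)%:E.
Proof.
rewrite /mean divfK ?gt_eqF// fineK//.
by rewrite ge0_fin_numE ?f_fin// integral_ge0.
Qed.

Lemma mean_ge0 i k x : (0 <= mean i k x)%R.
Proof. by rewrite divr_ge0 ?fine_ge0 ?integral_ge0// ltW. Qed.

Lemma prod_mean_ge0 k x : (0 <= prod_mean k x)%R.
Proof. by apply: prodr_ge0 => i _; exact: mean_ge0. Qed.

Lemma mean_cell i k x y : c k x = c k y -> mean i k x = mean i k y.
Proof. by move=> /cell_eq xy; rewrite /mean xy. Qed.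

Lemma prod_mean_cell k x y : c k x = c k y -> prod_mean k x = prod_mean k y.
Proof. by move=> xy; apply: eq_bigr => i _; rewrite (mean_cell i xy). Qed.

Lemma mean_gt0 i j k x y : (j <= k)%N -> c k x = c k y ->
  (0 < mean i j y)%R -> (0 < mean i k x)%R.
Proof.
move=> jk xy my.
suff : (0 < mean i k x * s k)%R by rewrite pmulr_lgt0.
rewrite -lte_fin -meanE; apply: (@lt_le_trans _ _ (\int[mu]_(z in cell c j y) (f i z)%:E)).
  by rewrite meanE lte_fin mulr_gt0.
apply: ge0_subset_integral => //; try exact: measurable_cell.
by move=> z /(coarse_leq c_coarse jk); rewrite /cell/= => ->.
Qed.

Variable K : nat.
Let A : R := (2 ^+ m)%R.
Let A_ge1 : (1 <= A)%R. Proof. by rewrite /A exprn_ege1// ler1n. Qed.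

Definition selected := principal prod_mean K A.

Lemma stopped_value_cell k x y : (k <= K)%N -> c k x = c k y ->
  stopped_value prod_mean K A k x = stopped_value prod_mean K A k y.
Proof.
move=> kK; rewrite -(subKn kK); elim: (K - k)%N => [|e IH].
  by rewrite subn0 !stopped_value_top => /prod_mean_cell.
have [eK|eK] := leqP K e.
  have -> : (K - e.+1 = K - e)%N by lia.
  exact: IH.
move=> xy; have e1 : (K - e = (K - e.+1).+1)%N by lia.
have eL : (K - e.+1 < K)%N by lia.
rewrite !(stopped_valueE _ A_ge1 _ eL) -e1.
by rewrite (prod_mean_cell xy) IH// e1; exact: c_coarse.
Qed.

Lemma selected_cell k x y : c k x = c k y -> selected k x = selected k y.
Proof.
move=> xy; rewrite /selected /principal; have [kK|//] /= := leqP k K.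
have [//|kK'] /= := eqVneq k K.
rewrite (prod_mean_cell xy) (stopped_value_cell _ (c_coarse xy))//.
by rewrite ltn_neqAle kK'.
Qed.

(** If a deeper scale is selected at [y], the product over [i] of the ratios of
    the means of [f i] at the two scales exceeds [2 ^ m], so their arithmetic
    mean exceeds 2.  That mean is the mean of [h], the sum of the [f i] divided
    by [m] times their mean over the given cell, and [h] has mean 1 over that
    cell: the dyadic maximal inequality concludes. *)
Lemma selected_sparse k x : selected k x ->
  mu (cell c k x `&` [set y | (0 < layer_count selected k y)%N]) <=
  (2^-1)%:E * mu (cell c k x).
Proof.
move=> kx; have kK : (k <= K)%N by case/andP: kx.
have mC := measurable_cell mc k x.
have selj y : cell c k x y -> (0 < layer_count selected k y)%N ->
    exists2 j : 'I_k, selected j y & (A * prod_mean k x < prod_mean j y)%R.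
  move=> yx; rewrite lt0n sum_nat_eq0 => /forallPn[j]; rewrite /= eqb0 negbK => jy.
  exists j => //; have := principal_below A_ge1 prod_mean_ge0 _ jy.
  move=> /(_ k); rewrite ltn_ord kK => /(_ isT).
  by rewrite (stopped_value_cell kK yx) (principal_stopped A_ge1 kx).
have [[i mi0]|pos] := pselect (exists i, mean i k x = 0%R).
  rewrite (_ : _ `&` _ = set0) ?measure0; last first.
    rewrite -subset0 => y [yx /= /(selj _ yx)[j _]].
    have -> : prod_mean j y = 0%R.
      apply/eqP/prodf_eq0; exists i => //; apply/eqP/le_anti.
      rewrite mean_ge0 andbT leNgt; apply/negP => /mean_gt0 => /(_ k x).
      by rewrite mi0 ltxx => h; move: (h (ltnW (ltn_ord j)) (esym yx)).
    by rewrite ltNge mulr_ge0 ?prod_mean_ge0// (le_trans _ A_ge1).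
  by rewrite mule_ge0// lee_fin.
have {}pos i : (0 < mean i k x)%R.
  by rewrite lt_neqAle mean_ge0 andbT eq_sym; apply/eqP => h; apply: pos; exists i.
pose h y : \bar R := \sum_(i < m) (m%:R^-1 / mean i k x)%:E * (f i y)%:E.
have g0 i : (0 <= m%:R^-1 / mean i k x)%R by rewrite divr_ge0 ?invr_ge0// ltW.
have mh i D : measurable_fun D (fun y => (m%:R^-1 / mean i k x)%:E * (f i y)%:E).
  exact: measurable_funeM.
have inth j y : \int[mu]_(z in cell c j y) h z =
    (m%:R^-1 * (\sum_(i < m) mean i j y / mean i k x) * s j)%:E.
  rewrite ge0_integral_sum//; last 2 first.
  - exact: measurable_cell.
  - by move=> i z _; rewrite mule_ge0 ?lee_fin.
  rewrite mulr_sumr mulr_suml -sumEFin; apply: eq_bigr => i _.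
  rewrite ge0_integralZl ?lee_fin//; last exact: measurable_cell.
  by rewrite meanE -EFinM; congr EFin; ring.
have h0 y : 0 <= h y by apply: sume_ge0 => i _; rewrite mule_ge0 ?lee_fin.
have mhT : measurable_fun setT h by exact: emeasurable_sum.
have := dyadic_maximal_weak mc c_coarse mu_cell mhT h0 (ler0n R 2)
  (saturated_cell (k := k) (x := x)).
rewrite inth mu_cell.
have -> : (m%:R^-1 * (\sum_(i < m) mean i k x / mean i k x) = 1 :> R)%R.
  under eq_bigr do rewrite divff ?gt_eqF//.
  by rewrite sumr_const card_ord mulVf// pnatr_eq0 -lt0n.
rewrite mul1r => H.
suff : 2%:E * mu (cell c k x `&` [set y | (0 < layer_count selected k y)%N]) <= (s k)%:E.
  move: (mu _) => [r| |]//=.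
    by rewrite -!EFinM !lee_fin => ?; lra.
    by rewrite gt0_muley ?lte_fin// leye_eq.
  by move=> _; rewrite leNye.
apply: le_trans H; apply: lee_wpmul2l; first by rewrite lee_fin.
apply: le_measure; rewrite ?inE.
- apply: measurableI => //.
  apply: (@saturated_measurable _ _ _ c mc 0%N) => y z yz /=.
  by rewrite (layer_count_cell c_coarse selected_cell k yz).
- apply: measurableI => //.
  apply: (@saturated_measurable _ _ _ c mc 0%N) => y z yz /= /existsP[j hj].
  by apply/existsP; exists j; rewrite -(cell_eq (coarse_leq c_coarse (leq0n j) yz)).
move=> y [yx cy]; split=> //=; have [j _ jy] := selj _ yx cy.
apply/existsP; exists j; rewrite inth -EFinM lte_fin ltr_pM2r//.
pose E i : R := (mean i j y / mean i k x)%R.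
have E0 i : (0 <= E i)%R by rewrite divr_ge0 ?mean_ge0.
have := prod_le_mean_exp E0; rewrite /E prodf_div.
rewrite -/(prod_mean j y) -/(prod_mean k x).
have px : (0 < prod_mean k x)%R by apply: prodr_gt0.
move=> /(lt_le_trans _) => /(_ A); rewrite ltr_pdivlMr// => /(_ jy).
rewrite /A ltr_pXn2r ?nnegrE ?mulr_ge0 ?invr_ge0 ?sumr_ge0// => i _.
exact: E0.
Qed.

End multilinear_sparse.

(** * The weak-type bound for one dyadic operator *)

Section weak_type_sparse.
Context d (T : measurableType d) (R : realType) (mu : {measure set T -> \bar R}).
Variables (I : countType) (c : nat -> T -> I) (s : nat -> R).
Hypothesis mc : forall k i, measurable (c k @^-1` [set i]).
Hypothesis c_coarse : forall k x y, c k x = c k y -> c k.+1 x = c k.+1 y.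
Hypothesis s_gt0 : forall k, (0 < s k)%R.
Hypothesis mu_cell : forall k x, mu (cell c k x) = (s k)%:E.

Variables (m : nat) (f : 'I_m -> T -> R).
Hypothesis m_gt0 : (0 < m)%N.
Hypothesis mf : forall i, measurable_fun setT (f i).
Hypothesis f_ge0 : forall i x, (0 <= f i x)%R.
Hypothesis f_fin : forall i k x, \int[mu]_(y in cell c k x) (f i y)%:E < +oo.

Variables (K : nat) (a beta : nat -> R).
Hypothesis a_ge0 : forall k, (0 <= a k)%R.
Hypothesis beta_ge0 : forall k, (0 <= beta k)%R.
Let b k : R := (\sum_(j < k.+1) a j)%R.
Hypothesis beta_exp : forall k, (beta k ^+ m = \sum_(j < k.+1) a j)%R.

Variables (u : 'I_m -> T -> R) (U : T -> R).
Hypothesis u_meas : forall i, measurable_fun setT (u i).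
Hypothesis u_ge0 : forall i x, (0 <= u i x)%R.
Hypothesis mU : measurable_fun setT U.
Hypothesis U_ge0 : forall x, (0 <= U x)%R.
Hypothesis U_exp : forall x, (U x ^+ m = \prod_(i < m) u i x)%R.

Variables (nu : 'I_m -> nat -> T -> \bar R) (v w : 'I_m -> T -> \bar R).
Variable tau : nat -> R.
Hypothesis mv : forall i, measurable_fun setT (v i).
Hypothesis mw : forall i, measurable_fun setT (w i).
Hypothesis w_ge0 : forall i x, 0 <= w i x.
Hypothesis tau_ge0 : forall L, (0 <= tau L)%R.
Hypothesis nu_ge0 : forall i k x, 0 <= nu i k x.
Hypothesis nu_v : forall i k x y, c k x = c k y -> nu i k x <= v i y.
Hypothesis thin : forall i L k x E, measurable E ->
  mu (cell c k x `&` E) <= (2^-1 ^+ L)%:E * mu (cell c k x) ->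
  \int[mu]_(y in cell c k x `&` E) (u i y)%:E <=
  (tau L)%:E * mu (cell c k x) * nu i k x.
Hypothesis v_w : forall i k x y, c k x = c k y ->
  (beta k / s k)%:E * \int[mu]_(z in cell c k x) v i z <= w i y.

Local Notation mean := (mean mu c s f).
Local Notation prod_mean := (prod_mean mu c s f).
Local Notation selected := (selected mu c s f K).

Definition selected_above thr k x : bool :=
  selected k x && (thr < (\sum_(j < k.+1) a j) * prod_mean k x)%R.

Let v_ge0 i x : 0 <= v i x.
Proof. exact: le_trans (nu_ge0 i 0%N x) (nu_v _ _). Qed.

Lemma selected_above_cell thr k x y : c k x = c k y ->
  selected_above thr k x = selected_above thr k y.
Proof.
move=> xy; rewrite /selected_above (prod_mean_cell mu s f xy).
by rewrite (selected_cell mu s c_coarse f m_gt0 K xy).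
Qed.

Lemma selected_above_sparse thr k x : selected_above thr k x ->
  mu (cell c k x `&` [set y | (0 < layer_count (selected_above thr) k y)%N]) <=
  (2^-1)%:E * mu (cell c k x).
Proof.
move=> /andP[sk _].
apply: le_trans (selected_sparse mc c_coarse s_gt0 mu_cell m_gt0 mf f_ge0 f_fin sk).
have mset (q : nat -> T -> bool) :
    (forall j y z, c j y = c j z -> q j y = q j z) ->
    measurable (cell c k x `&` [set y | (0 < layer_count q k y)%N]).
  move=> qc; apply: measurableI; first exact: measurable_cell.
  apply: (@saturated_measurable _ _ _ c mc 0%N) => y z yz /=.
  by rewrite (layer_count_cell c_coarse qc k yz).
apply: le_measure; rewrite ?inE.
- by apply: mset => j y z; exact: selected_above_cell.
- by apply: mset => j y z; exact: (selected_cell mu s c_coarse f m_gt0).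
move=> y [yx /= cy]; split=> //=; apply: leq_trans cy _.
by apply: leq_sum => j _; rewrite /selected_above; case: (selected j y) => //=; exact: leq_b1.
Qed.

Definition test_mean x : \bar R := \sum_(i < m) (m%:R^-1)%:E * ((f i x)%:E * w i x).

Let fw_ge0 i x : 0 <= (m%:R^-1)%:E * ((f i x)%:E * w i x).
Proof. by rewrite !mule_ge0 ?lee_fin ?invr_ge0. Qed.

Let mfw i : measurable_fun setT (fun x => (m%:R^-1)%:E * ((f i x)%:E * w i x)).
Proof. by apply/measurable_funeM/emeasurable_funM => //; exact/measurable_EFinP. Qed.

Let mtest : measurable_fun setT test_mean.
Proof. exact: emeasurable_sum. Qed.

Let test_ge0 x : 0 <= test_mean x.
Proof. exact: sume_ge0. Qed.

Let mcw (g : T -> R) thr k L : measurable_fun setT g ->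
  measurable_fun setT
    (fun y => (layer_count (selected_above thr) k y - L)%N%:R%:E * (g y)%:E).
Proof.
move=> mg; apply: emeasurable_funM; last exact/measurable_EFinP.
apply: (cellwise_measurable mc (k := 0%N)) => y z yz.
by rewrite (layer_count_cell c_coarse (selected_above_cell thr) k yz).
Qed.

Let cw_ge0 (g : T -> R) thr k L y : (0 <= g y)%R ->
  0 <= (layer_count (selected_above thr) k y - L)%N%:R%:E * (g y)%:E.
Proof. by move=> g0; rewrite mule_ge0 ?lee_fin. Qed.

(** With [al i] the product of [beta k] and the mean of [f i], the product of the
    [al i] is [b k * prod_mean k > thr], so [thr * U] is at most the mean of the
    [al i * u i] (here [thr <= 1] absorbs the [m]-th root).  The single-weight
    bound applies to each [u i], and [al i] times the integral of [v i] is the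
    integral of [f i] against [beta k] times the mean of [v i], hence at most
    that of [f i * w i]. *)
Lemma excess_on_selected thr L k x : (0 < thr <= 1)%R -> selected_above thr k x ->
  thr%:E * \int[mu]_(y in cell c k x)
     ((layer_count (selected_above thr) k.+1 y - L)%N%:R%:E * (U y)%:E) <=
  (2 * tau L)%:E * \int[mu]_(y in cell c k x) test_mean y.
Proof.
move=> /andP[thr0 thr1] kx; have mC := measurable_cell mc k x.
have bF : (thr < b k * prod_mean k x)%R by case/andP: kx.
pose al i : R := (beta k * mean i k x)%R.
have al0 i : (0 <= al i)%R by rewrite mulr_ge0// mean_ge0.
have prodal : (\prod_(i < m) al i = b k * prod_mean k x)%R.
  by rewrite big_split /= prodr_const card_ord beta_exp.
have mi0 : (0 <= m%:R^-1 :> R)%R by rewrite invr_ge0.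
have ptw y : (thr * U y <= \sum_(i < m) m%:R^-1 * al i * u i y)%R.
  have S0 : (0 <= \sum_(i < m) m%:R^-1 * al i * u i y)%R.
    by apply: sumr_ge0 => i _; rewrite mulr_ge0// mulr_ge0.
  rewrite -(ler_pXn2r m_gt0) ?nnegrE ?mulr_ge0 ?(ltW thr0)// exprMn U_exp.
  apply: (@le_trans _ _ (\prod_(i < m) (al i * u i y))%R).
    rewrite big_split /= prodal ler_wpM2r ?prodr_ge0//.
    by apply: le_trans (ltW bF); rewrite ler_iXnr// ltW.
  have alu0 i : (0 <= al i * u i y)%R by rewrite mulr_ge0.
  apply: (le_trans (prod_le_mean_exp alu0)).
  by rewrite mulr_sumr le_eqVlt; under eq_bigr do rewrite mulrA; rewrite eqxx.
rewrite -ge0_integralZl//; last 3 first.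
- exact: measurable_funTS (mcw thr k.+1 L mU).
- by move=> y _; exact: cw_ge0.
- by rewrite lee_fin ltW.
apply: (@le_trans _ _ (\int[mu]_(y in cell c k x) \sum_(i < m)
    ((m%:R^-1 * al i)%:E *
      ((layer_count (selected_above thr) k.+1 y - L)%N%:R%:E * (u i y)%:E)))).
  apply: ge0_le_integral => //.
  - by move=> y _; rewrite mule_ge0 ?cw_ge0// lee_fin ltW.
  - by apply: measurable_funeM; exact: measurable_funTS (mcw thr k.+1 L mU).
  - apply: emeasurable_sum => i.
    by apply: measurable_funeM; exact: measurable_funTS (mcw thr k.+1 L (u_meas i)).
  move=> y _; under eq_bigr do rewrite -!EFinM.
  rewrite sumEFin -!EFinM lee_fin mulrCA.
  under eq_bigr do rewrite mulrCA.
  by rewrite -mulr_sumr ler_wpM2l.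
rewrite ge0_integral_sum//; last 2 first.
- by move=> i; apply: measurable_funeM; exact: measurable_funTS (mcw thr k.+1 L (u_meas i)).
- by move=> i y _; rewrite mule_ge0 ?cw_ge0// lee_fin mulr_ge0.
rewrite ge0_integral_sum//; last first.
- by move=> i; exact: measurable_funTS.
rewrite ge0_sume_distrr; last first.
  by move=> i _; apply: integral_ge0 => y _; exact: fw_ge0.
apply: lee_sum => i _.
have g0 : (0 <= m%:R^-1 * al i)%R by rewrite mulr_ge0.
rewrite ge0_integralZl//; last 2 first.
- exact: measurable_funTS (mcw thr k.+1 L (u_meas i)).
- by move=> y _; exact: cw_ge0.
have B := excess_count_step mc c_coarse mu_cell (selected_above_cell thr)
  (@selected_above_sparse thr) (u_meas i) (u_ge0 i) (mv i) (tau_ge0 L) (nu_ge0 i)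
  (@nu_v i) (@thin i L) (saturated_cell (k := k) (x := x))
  (excess_count_le mc c_coarse mu_cell (selected_above_cell thr)
  (@selected_above_sparse thr) (u_meas i) (u_ge0 i) (mv i) (tau_ge0 L) (nu_ge0 i)
  (@nu_v i) (@thin i L) (saturated_cell (k := k) (x := x))).
have {}B := lee_wpmul2l (g0 : 0%E <= (m%:R^-1 * al i)%:E) B.
apply: (le_trans B); rewrite muleCA; apply: lee_wpmul2l.
  by rewrite lee_fin mulr_ge0.
apply: (@le_trans _ _ ((m%:R^-1 * al i)%:E * \int[mu]_(y in cell c k x) v i y)).
  apply: lee_wpmul2l => //; apply: ge0_le_integral => //.
  - by move=> y _; rewrite mule_ge0 ?lee_fin.
  - apply: emeasurable_funM; last exact: measurable_funTS.
    apply/measurable_funTS/(cellwise_measurable mc (k := 0%N)) => y z yz.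
    by rewrite (layer_count_cell c_coarse (selected_above_cell thr) k.+1 yz).
  - exact: measurable_funTS.
  move=> y _; case: (0 < _)%N; first by rewrite mulr1n mul1e.
  by rewrite mulr0n mul0e.
rewrite ge0_integralZl//; last 2 first.
- by apply/measurable_funTS/emeasurable_funM => //; exact/measurable_EFinP.
- by move=> y _; rewrite mule_ge0 ?lee_fin.
rewrite EFinM -muleA; apply: lee_wpmul2l; first by rewrite lee_fin.
have -> : (al i)%:E * \int[mu]_(y in cell c k x) v i y =
    \int[mu]_(y in cell c k x) ((f i y)%:E *
      ((beta k / s k)%:E * \int[mu]_(z in cell c k x) v i z)).
  rewrite ge0_integralZr//.
  - rewrite (meanE s_gt0 f_ge0 f_fin) muleA -EFinM; congr (_%:E * _).
    by rewrite /al; have := s_gt0 k => sk; field; rewrite gt_eqF.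
  - exact/measurable_funTS/measurable_EFinP.
  - by move=> y _; rewrite lee_fin.
  - by rewrite mule_ge0 ?integral_ge0// lee_fin divr_ge0// ltW.
apply: ge0_le_integral => //.
- move=> y _; rewrite !mule_ge0 ?lee_fin ?integral_ge0//.
  by rewrite divr_ge0// ltW.
- apply: emeasurable_funM => //; exact/measurable_funTS/measurable_EFinP.
- apply: emeasurable_funM; last exact: measurable_funTS.
  exact/measurable_funTS/measurable_EFinP.
move=> y yx; apply: lee_wpmul2l; rewrite ?lee_fin//.
by apply: v_w; rewrite yx.
Qed.

(** Only the largest selected cells matter: on a cell that is not selected the
    layer_count is that of the finer scales, on a selected one [excess_on_selected]
    applies. *)
Lemma excess_le_test thr L k G : (0 < thr <= 1)%R -> saturated c k G ->
  thr%:E * \int[mu]_(y in G)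
     ((layer_count (selected_above thr) k y - L)%N%:R%:E * (U y)%:E) <=
  (2 * tau L)%:E * \int[mu]_(y in G) test_mean y.
Proof.
move=> thr01; have thr0 : 0%E <= thr%:E by case/andP: thr01 => /ltW.
have t0 : 0%E <= (2 * tau L)%:E by rewrite lee_fin mulr_ge0.
elim: k G => [|k IH] G sG.
  rewrite integral0_eq.
    by rewrite mule0 mule_ge0 ?integral_ge0.
  by move=> y _; rewrite /layer_count big_ord0 sub0n mulr0n mul0e.
have {}sG := saturated_leq c_coarse (leqnSn k) sG.
have mG := saturated_measurable mc sG.
have ZU (D : set T) : measurable D -> \int[mu]_(y in D) (thr%:E *
      ((layer_count (selected_above thr) k.+1 y - L)%N%:R%:E * (U y)%:E)) =
    thr%:E * \int[mu]_(y in D)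
      ((layer_count (selected_above thr) k.+1 y - L)%N%:R%:E * (U y)%:E).
  move=> mD; apply: ge0_integralZl => //.
    exact: measurable_funTS (mcw thr k.+1 L mU).
  by move=> y _; exact: cw_ge0.
have Zt (D : set T) : measurable D ->
    \int[mu]_(y in D) ((2 * tau L)%:E * test_mean y) =
    (2 * tau L)%:E * \int[mu]_(y in D) test_mean y.
  by move=> mD; apply: ge0_integralZl => //; exact: measurable_funTS.
rewrite -ZU// -Zt//; apply: (cellwise_le_integral mc sG) => //.
- by apply: measurable_funeM; exact: mcw.
- exact: measurable_funeM.
- by move=> y; rewrite mule_ge0 ?cw_ge0.
- by move=> y; rewrite mule_ge0.
move=> x _; have mC := measurable_cell mc k x.
rewrite ZU// Zt//.
have [kx|/negbTE kx] := boolP (selected_above thr k x).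
  exact: excess_on_selected.
apply: le_trans (IH _ (saturated_cell (k := k) (x := x))).
apply: lee_wpmul2l => //; rewrite le_eqVlt; apply/orP; left; apply/eqP.
apply: eq_integral => y; rewrite inE => yx.
by rewrite layer_countS (selected_above_cell thr yx) kx addn0.
Qed.

(** Where no selected product [b k * F k] exceeds 1, the layers up to [2 ^ j.+1]
    of the threshold [4 ^ - j.+1] contribute at most 4, and the values below the
    last threshold at most 1; since S exceeds [6 * 2 ^ m] the excess layers must
    account for at least 1. *)
Lemma selected_layers x :
  (6 * 2 ^+ m < \sum_(k < K.+1) a k * prod_mean k x)%R ->
  (1 <= (layer_count (selected_above 1) K.+1 x)%:R +
    \sum_(j < K.+1) 4^-1 ^+ j *
      (layer_count (selected_above (4^-1 ^+ j.+1)) K.+1 x - 2 ^ j.+1)%N%:R :> R)%R.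
Proof.
move=> big.
have e0 j : (0 <= 4^-1 ^+ j :> R)%R by rewrite exprn_ge0.
have S0 : (0 <= \sum_(j < K.+1) 4^-1 ^+ j *
    (layer_count (selected_above (4^-1 ^+ j.+1)) K.+1 x - 2 ^ j.+1)%N%:R :> R)%R.
  by apply: sumr_ge0 => j _; rewrite mulr_ge0.
have [c0|c_gt0] := posnP (layer_count (selected_above 1%R) K.+1 x); last first.
  by rewrite -[leLHS]addr0 lerD// ler1n.
rewrite c0 add0r.
have A1 : (1 <= 2 ^+ m :> R)%R by rewrite exprn_ege1// ler1n.
pose cc k : R := ((\sum_(i < k.+1) a i) * prod_mean k x)%R.
have cc0 k : (0 <= cc k)%R.
  by rewrite mulr_ge0 ?sumr_ge0// prod_mean_ge0.
have cc1 (k : 'I_K.+1) : selected k x -> (cc k <= 1)%R.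
  move=> kx; rewrite leNgt; apply/negP => h.
  move/eqP: c0; rewrite /layer_count sum_nat_eq0 => /forallP/(_ k).
  by rewrite /= /selected_above kx h.
have : (6 < \sum_(k < K.+1) (selected k x)%:R * cc k)%R.
  rewrite -(ltr_pM2l (lt_le_trans ltr01 A1)) mulrC; apply: (lt_le_trans big).
  exact: (sum_le_sum_principal K A1 (prod_mean_ge0 mu c s_gt0 f_ge0) x a_ge0).
have : (\sum_(k < K.+1) (selected k x)%:R * cc k <=
    \sum_(j < K.+1) 4^-1 ^+ j *
      (layer_count (selected_above (4^-1 ^+ j.+1)) K.+1 x)%:R + 1 :> R)%R.
  apply: (@le_trans _ _ (\sum_(k < K.+1) (\sum_(j < K.+1) 4^-1 ^+ j *
      (selected_above (4^-1 ^+ j.+1) k x)%:R + 4^-1 ^+ K.+1)))%R.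
    apply: ler_sum => k _; rewrite /selected_above.
    case: (boolP (selected k x)) => kx /=; last first.
      by rewrite mul0r addr_ge0// sumr_ge0// => j _; rewrite mulr_ge0.
    by rewrite mul1r dyadic_layers// cc0 cc1.
  rewrite big_split/= exchange_big/=; apply: lerD.
    by apply: ler_sum => j _; rewrite -mulr_sumr natr_sum.
  rewrite sumr_const card_ord -[leLHS]mulr_natl exprVn.
  rewrite ler_pdivrMr ?mul1r ?exprn_gt0//.
  by rewrite -natrX ler_nat ltnW// ltn_expl.
have : (\sum_(j < K.+1) 4^-1 ^+ j *
    (layer_count (selected_above (4^-1 ^+ j.+1)) K.+1 x)%:R <=
    \sum_(j < K.+1) 4^-1 ^+ j *
      (layer_count (selected_above (4^-1 ^+ j.+1)) K.+1 x - 2 ^ j.+1)%N%:R +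
    \sum_(j < K.+1) 2 * 2^-1 ^+ j :> R)%R.
  rewrite -big_split/=; apply: ler_sum => j _.
  have -> : (2 * 2^-1 ^+ j = 4^-1 ^+ j * (2 ^ j.+1)%N%:R :> R)%R.
    rewrite natrX exprS mulrCA; congr (_ * _)%R.
    by rewrite -exprMn; congr (_ ^+ _)%R; lra.
  rewrite -mulrDr ler_wpM2l// -natrD ler_nat; lia.
have : (\sum_(j < K.+1) 2 * 2^-1 ^+ j <= 4 :> R)%R.
  suff -> : (\sum_(j < K.+1) 2 * 2^-1 ^+ j = 4 - 4 * 2^-1 ^+ K.+1 :> R)%R.
    by rewrite gerBl mulr_ge0// exprn_ge0.
  elim: (K.+1) => [|n IH]; first by rewrite big_ord0 expr0; lra.
  by rewrite big_ord_recr/= IH exprSr; lra.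
by lra.
Qed.

Let scaled_le (t r : R) (X : \bar R) : (0 < t)%R -> t%:E * X <= r%:E ->
  X <= (r / t)%:E.
Proof.
move=> t0; case: X => [x| |].
- by rewrite -EFinM !lee_fin ler_pdivlMr// mulrC.
- by rewrite gt0_muley ?lte_fin// leye_eq.
- by rewrite leNye.
Qed.

Variables (rho Ctau : R).
Hypothesis fw_le : forall i, \int[mu]_x ((f i x)%:E * w i x) <= rho%:E.
Hypothesis Ctau_le : forall J,
  (2 * tau 0 + 8 * \sum_(j < J) tau (2 ^ j.+1)%N <= Ctau)%R.

(** Integrate [selected_layers] against [U]; the loss [4 ^ j.+1] of
    [excess_le_test] at the threshold [4 ^ - j.+1] is compensated by the weight
    [4 ^ - j], so only the sum of the [tau (2 ^ j.+1)] remains. *)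
Lemma weak_type_normalized :
  \int[mu]_(x in [set x | (6 * 2 ^+ m <
    \sum_(k < K.+1) a k * prod_mean k x)%R]) (U x)%:E <= (Ctau * rho)%:E.
Proof.
have test_le : \int[mu]_x test_mean x <= rho%:E.
  rewrite ge0_integral_sum//.
  apply: (@le_trans _ _ (\sum_(i < m) (m%:R^-1 * rho)%:E)).
    apply: lee_sum => i _; rewrite ge0_integralZl//; last 2 first.
    - by apply: emeasurable_funM => //; exact/measurable_EFinP.
    - by move=> x _; rewrite mule_ge0 ?lee_fin.
    by rewrite EFinM lee_wpmul2l// lee_fin invr_ge0.
  rewrite sumEFin sumr_const card_ord -[X in X%:E]mulr_natl mulrA divff ?mul1r//.
  by rewrite pnatr_eq0 -lt0n.
have rho0 : (0 <= rho)%R by rewrite -lee_fin; apply: le_trans test_le; exact: integral_ge0.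
pose N thr L x : \bar R :=
  (layer_count (selected_above thr) K.+1 x - L)%N%:R%:E * (U x)%:E.
have mN thr L : measurable_fun setT (N thr L) by exact: mcw.
have N0 thr L x : 0 <= N thr L x by exact: cw_ge0.
have intN thr L : (0 < thr <= 1)%R ->
    \int[mu]_x N thr L x <= (2 * tau L * rho / thr)%:E.
  move=> thr01; have thr0 : (0 < thr)%R by case/andP: thr01.
  apply: scaled_le => //.
  have sT : saturated c K.+1 setT by [].
  apply: (le_trans (excess_le_test L thr01 sT)).
  by rewrite [leRHS]EFinM lee_wpmul2l// lee_fin mulr_ge0.
have e0 j : (0 < 4^-1 ^+ j :> R)%R by rewrite exprn_gt0.
pose E := [set x | (6 * 2 ^+ m < \sum_(k < K.+1) a k * prod_mean k x)%R].
have mE : measurable E.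
  apply: (@saturated_measurable _ _ _ c mc 0%N) => x y xy; rewrite /E/=.
  under eq_bigr => k _ do
    rewrite (prod_mean_cell mu s f (coarse_leq c_coarse (leq0n k) xy)).
  by [].
pose W x : \bar R := N 1%R 0%N x +
  \sum_(j < K.+1) (4^-1 ^+ j)%:E * N (4^-1 ^+ j.+1)%R (2 ^ j.+1)%N x.
have S0 x : 0 <= \sum_(j < K.+1) (4^-1 ^+ j)%:E * N (4^-1 ^+ j.+1)%R (2 ^ j.+1)%N x.
  by apply: sume_ge0 => j _; rewrite mule_ge0// lee_fin ltW.
have mS : measurable_fun setT (fun x =>
    \sum_(j < K.+1) (4^-1 ^+ j)%:E * N (4^-1 ^+ j.+1)%R (2 ^ j.+1)%N x).
  by apply: emeasurable_sum => j; exact: measurable_funeM.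
have W0 x : 0 <= W x by rewrite adde_ge0.
have mW : measurable_fun setT W by exact: emeasurable_funD.
apply: (@le_trans _ _ (\int[mu]_(x in E) W x)).
  apply: ge0_le_integral => //.
  - by move=> x _; rewrite lee_fin.
  - exact/measurable_funTS/measurable_EFinP.
  - exact: measurable_funTS.
  move=> x /selected_layers h; rewrite /W /N.
  under eq_bigr do rewrite -!EFinM.
  rewrite sumEFin -EFinM -EFinD lee_fin subn0.
  under eq_bigr do rewrite mulrA.
  by rewrite -mulr_suml -mulrDl ler_peMl.
apply: (@le_trans _ _ (\int[mu]_x W x)).
  exact: ge0_subset_integral.
rewrite ge0_integralD// ge0_integral_sum//; last 2 first.
- by move=> j; exact: measurable_funeM.
- by move=> j x _; rewrite mule_ge0// lee_fin ltW.
apply: (@le_trans _ _ ((2 * tau 0%N * rho)%:E +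
    \sum_(j < K.+1) (8 * tau (2 ^ j.+1)%N * rho)%:E)); last first.
  rewrite sumEFin -EFinD lee_fin -mulr_suml -mulrDl ler_wpM2r//.
  by apply: le_trans (Ctau_le K.+1); rewrite -mulr_sumr.
apply: leeD.
  have := intN 1%R 0%N; rewrite divr1; apply.
  by rewrite ltr01 lexx.
apply: lee_sum => j _; rewrite ge0_integralZl ?lee_fin ?(ltW (e0 j))//.
apply: (@le_trans _ _ ((4^-1 ^+ j)%:E *
    (2 * tau (2 ^ j.+1)%N * rho / 4^-1 ^+ j.+1)%:E)).
  apply: lee_wpmul2l; first by rewrite lee_fin ltW.
  by apply: intN; rewrite e0 exprn_ile1//; lra.
rewrite -EFinM lee_fin exprSr invfM invrK.
have := e0 j; set q := (4^-1 ^+ j)%R => q0.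
rewrite le_eqVlt; apply/orP; left; apply/eqP; field.
by rewrite gt_eqF.
Qed.

End weak_type_sparse.

(** * The function L(log L)^delta on exponentially thin sets *)

Section LlogL_facts.
Context {R : realType}.
Variable delta : R.
Hypothesis delta_gt0 : (0 < delta)%R.

Lemma measurable_LlogL : measurable_fun setT (@LlogL R delta).
Proof.
apply: measurable_funM => //.
apply: (measurableT_comp (measurable_powR delta)).
apply: measurable_funD => //; exact: measurable_maxr.
Qed.

Lemma LlogL_ge0 t : (0 <= t)%R -> (0 <= LlogL delta t)%R.
Proof. by move=> t0; rewrite mulr_ge0// powR_ge0. Qed.

Lemma le_LlogL t1 t2 : (0 <= t1 <= t2)%R -> (LlogL delta t1 <= LlogL delta t2)%R.
Proof.
move=> /andP[t10 t12]; apply: ler_pM => //; first exact: powR_ge0.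
have [t1_0|t1_gt0] := leP t1 0%R.
  rewrite ln0// maxxx addr0 powR1.
  have e1 : (1 `^ delta = 1 :> R)%R by rewrite powR1.
  rewrite -[leLHS]e1 ge0_ler_powR ?(ltW delta_gt0)// ?nnegrE//.
    by rewrite addr_ge0// le_max lexx.
  by rewrite lerDl le_max lexx.
apply: ge0_ler_powR; rewrite ?(ltW delta_gt0)// ?nnegrE ?addr_ge0// ?le_max ?lexx//.
by rewrite lerD2l ge_max !le_max lexx/= ler_ln ?posrE ?(lt_le_trans t1_gt0)// t12 orbT.
Qed.

Lemma LlogL_le1 t : (0 <= t <= 1)%R -> (LlogL delta t <= 1)%R.
Proof.
move=> /le_LlogL /le_trans; apply.
by rewrite /LlogL ln1 maxxx addr0 powR1 mulr1.
Qed.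

(** Fraction of the mass that a set of relative measure [2 ^ - L] can carry:
    values below [(3 / 2) ^ L] are bounded by the measure of the set, larger ones
    by the growth of L(log L)^delta. *)
Definition thinness (L : nat) : R :=
  ((3 / 4) ^+ L + (1 + L%:R * ln (3 / 2)) `^ (- delta))%R.

Let ln32 : (0 < ln (3 / 2) :> R)%R.
Proof. by rewrite ln_gt0//; lra. Qed.

Lemma thinness_gt0 L : (0 < thinness L)%R.
Proof. by rewrite ltr_pwDl ?powR_ge0// exprn_gt0//; lra. Qed.

(** Above [(3 / 2) ^ L] the logarithm of [t] is at least [L * ln (3 / 2)]. *)
Lemma le_LlogL_split L t : (0 <= t)%R ->
  (t <= (3 / 2) ^+ L + (1 + L%:R * ln (3 / 2)) `^ (- delta) * LlogL delta t)%R.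
Proof.
move=> t0; have [tT|Tt] := leP t ((3 / 2) ^+ L)%R.
  by rewrite (le_trans tT)// lerDl mulr_ge0 ?powR_ge0 ?LlogL_ge0.
have T0 : (0 < (3 / 2 : R) ^+ L)%R by rewrite exprn_gt0.
rewrite -[leLHS]add0r; apply: lerD; first exact: ltW.
have l0 : (0 <= L%:R * ln (3 / 2) :> R)%R by rewrite mulr_ge0// ltW.
have l1 : (0 < 1 + L%:R * ln (3 / 2) :> R)%R by rewrite ltr_pwDl.
have lnt : (L%:R * ln (3 / 2) <= Num.max 0 (ln t))%R.
  rewrite le_max; apply/orP; right; rewrite mulr_natl -lnXn; last lra.
  by rewrite ler_ln ?posrE ?(ltW Tt)// (lt_trans T0).
rewrite /LlogL mulrCA ler_peMr// powRN mulrC ler_pdivlMr ?powR_gt0// mul1r.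
apply: ge0_ler_powR; rewrite ?(ltW delta_gt0)// ?nnegrE ?(ltW l1)//.
  by rewrite addr_ge0// le_max lexx.
by rewrite lerD2l.
Qed.

Lemma sum_geometric_le (q : R) J : (0 <= q < 1)%R ->
  (\sum_(j < J) q ^+ j <= (1 - q)^-1)%R.
Proof.
move=> /andP[q0 q1]; have q1' : (0 < 1 - q)%R by rewrite subr_gt0.
rewrite -[leRHS]mul1r ler_pdivlMr// mulrC -opprB mulNr -subrX1 opprB.
by rewrite gerBl exprn_ge0.
Qed.

Lemma thinness_exp2_le j : (thinness (2 ^ j.+1)%N <=
  (3 / 4) ^+ j + ln (3 / 2) `^ (- delta) * (2 `^ (- delta)) ^+ j)%R.
Proof.
have jj : (j <= 2 ^ j.+1)%N by rewrite ltnW// (ltn_trans (ltn_expl j (ltnSn 1)))// ltn_exp2l.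
apply: lerD; first by rewrite ler_wiXn2l//; lra.
rewrite -(powR_mulrn j (powR_ge0 2 _)) powRAC powR_mulrn// [leRHS]mulrC.
rewrite -powRM ?exprn_ge0 ?(ltW ln32)//.
have p0 : (0 < 2 ^+ j * ln (3 / 2) :> R)%R by rewrite mulr_gt0// exprn_gt0.
have p1 : (0 < 1 + (2 ^ j.+1)%N%:R * ln (3 / 2) :> R)%R.
  by rewrite ltr_pwDl// mulr_ge0// ltW.
rewrite !powRN lef_pV2 ?posrE ?powR_gt0//.
apply: ge0_ler_powR; rewrite ?(ltW delta_gt0)// ?nnegrE ?(ltW p0)//.
  by rewrite addr_ge0// mulr_ge0// ltW.
rewrite -[leLHS]add0r lerD// ler_wpM2r ?(ltW ln32)// natrX.
by rewrite ler_weXn2l// ler1n.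
Qed.

(** Along [L = 2 ^ j] the thinness decays like [2 ^ (- j * delta)]: this is how the
    exponent [delta] makes the sum over the classes converge. *)
Lemma sum_thinness_le : exists C : R, (0 < C)%R /\ forall J,
  (2 * thinness 0 + 8 * \sum_(j < J) thinness (2 ^ j.+1)%N <= C)%R.
Proof.
set l := (ln (3 / 2) `^ (- delta) : R)%R; set q := (2 `^ (- delta) : R)%R.
have l0 : (0 <= l)%R by exact: powR_ge0.
have q01 : (0 <= q < 1)%R.
  rewrite powR_ge0/= /q powRN invf_lt1 ?powR_gt0//.
  have e1 : (1 `^ delta = 1 :> R)%R by rewrite powR1.
  rewrite -[ltLHS]e1 gt0_ltr_powR// ?nnegrE//; lra.
exists (2 * thinness 0 + 8 * ((1 - 3 / 4)^-1 + l * (1 - q)^-1))%R; split.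
  rewrite ltr_pwDl ?mulr_gt0 ?thinness_gt0// mulr_ge0// addr_ge0//.
    by rewrite invr_ge0; lra.
  by rewrite mulr_ge0// invr_ge0 subr_ge0 ltW//; case/andP: q01.
move=> J; rewrite lerD2l ler_pM2l//.
apply: (@le_trans _ _ (\sum_(j < J) ((3 / 4) ^+ j + l * q ^+ j))%R).
  by apply: ler_sum => j _; exact: thinness_exp2_le.
rewrite big_split/= -mulr_sumr; apply: lerD; first by apply: sum_geometric_le; lra.
by rewrite ler_wpM2l// sum_geometric_le.
Qed.

Section thin_sets.
Context d (T : measurableType d) (mu : {measure set T -> \bar R}).

(** The constant [(3 / 2) ^ L] of [le_LlogL_split] is integrated over the thin set
    only, and the other term over all of [P], where [lam] controls it. *)
Lemma integral_thin_le (u : T -> R) (P E : set T) (s lam : R) L :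
  measurable_fun setT u -> (forall x, 0 <= u x)%R ->
  measurable P -> measurable E -> (0 < s)%R -> mu P = s%:E -> (0 < lam)%R ->
  (s^-1)%:E * \int[mu]_(x in P) (LlogL delta (u x / lam))%:E <= 1 ->
  mu (P `&` E) <= (2^-1 ^+ L)%:E * mu P ->
  \int[mu]_(x in P `&` E) (u x)%:E <= (thinness L * s * lam)%:E.
Proof.
move=> u_meas u0 mP mE s0 mus lam0 avg1 thinE.
have mPE : measurable (P `&` E) by exact: measurableI.
set g := ((1 + L%:R * ln (3 / 2)) `^ (- delta))%R.
have g0 : (0 <= g)%R by exact: powR_ge0.
have ul0 x : (0 <= u x / lam)%R by rewrite divr_ge0// ltW.
have mB : measurable_fun setT (fun x => (LlogL delta (u x / lam))%:E).
  apply/measurable_EFinP; apply: (measurableT_comp measurable_LlogL).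
  exact: measurable_funM.
have T0 : (0 <= (3 / 2 : R) ^+ L)%R by rewrite exprn_ge0//; lra.
have intB : \int[mu]_(x in P) (LlogL delta (u x / lam))%:E <= s%:E.
  move: avg1; case: (\int[mu]_(x in P) _) => [r| |].
  - by rewrite -EFinM !lee_fin ler_pdivrMl// mulr1.
  - by rewrite gt0_muley ?lte_fin ?invr_gt0// leye_eq.
  - by rewrite leNye.
apply: (@le_trans _ _ (\int[mu]_(x in P `&` E)
    ((lam * (3 / 2) ^+ L)%:E + (lam * g)%:E * (LlogL delta (u x / lam))%:E))).
  apply: ge0_le_integral => //.
  - by move=> x _; rewrite lee_fin.
  - exact/measurable_funTS/measurable_EFinP.
  - apply: emeasurable_funD => //; apply: measurable_funeM.
    exact: measurable_funTS.
  move=> x _; rewrite -EFinM -EFinD lee_fin -mulrA -mulrDr.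
  rewrite mulrC -ler_pdivrMr//; exact: le_LlogL_split.
have c0 : (0 <= lam * (3 / 2) ^+ L)%R by rewrite mulr_ge0// ltW.
have g1 : (0 <= lam * g)%R by rewrite mulr_ge0// ltW.
have B0 x : 0 <= (LlogL delta (u x / lam))%:E by rewrite lee_fin LlogL_ge0.
have mB' (D : set T) : measurable_fun D (fun x => (LlogL delta (u x / lam))%:E).
  exact: measurable_funTS.
rewrite ge0_integralD//; last 2 first.
- by move=> x _; rewrite mule_ge0.
- exact: measurable_funeM.
rewrite (integral_cst mu mPE) ge0_integralZl//.
have -> : (thinness L * s * lam = (3 / 4) ^+ L * s * lam + g * s * lam)%R.
  by rewrite -!mulrDl.
rewrite EFinD; apply: leeD.
  apply: (@le_trans _ _ ((lam * (3 / 2) ^+ L)%:E * ((2^-1 ^+ L)%:E * s%:E))).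
    by apply: lee_wpmul2l; rewrite -?mus// lee_fin mulr_ge0// ltW.
  rewrite -!EFinM lee_fin.
  have -> : ((3 / 4) ^+ L = (3 / 2) ^+ L * 2^-1 ^+ L :> R)%R.
    by rewrite -exprMn; congr (_ ^+ _)%R; lra.
  set p := ((3 / 2) ^+ L)%R; set q := (2^-1 ^+ L)%R.
  by rewrite le_eqVlt; apply/orP; left; apply/eqP; ring.
apply: (@le_trans _ _ ((lam * g)%:E * s%:E)).
  apply: lee_wpmul2l; first by rewrite lee_fin mulr_ge0// ltW.
  apply: le_trans intB; exact: ge0_subset_integral.
by rewrite -EFinM lee_fin le_eqVlt; apply/orP; left; apply/eqP; ring.
Qed.

End thin_sets.
End LlogL_facts.

(** * Integrals of functions that are not Borel *)

Section lower_integral.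
Context d (T : measurableType d) (R : realType) (mu : {measure set T -> \bar R}).

(** The integral of a nonnegative function is the supremum of the integrals of
    the simple functions below it, so it is monotone for arbitrary functions. *)
Lemma le_lower_integral (D D' : set T) (f g : T -> \bar R) :
  (forall x, D x -> 0 <= f x) -> (forall x, D' x -> 0 <= g x) ->
  (forall x, D x -> D' x /\ f x <= g x) ->
  \int[mu]_(x in D) f x <= \int[mu]_(x in D') g x.
Proof.
move=> f0 g0 fg; rewrite integral_mkcond [leRHS]integral_mkcond.
rewrite !ge0_integralTE; last 2 first.
- by move=> x; apply: erestrict_ge0.
- by move=> x; apply: erestrict_ge0.
apply: ge_ereal_sup => _ [h hf <-]; apply: ereal_sup_ubound; exists h => //= x.
apply: (le_trans (hf x)); rewrite /patch.
case: ifPn => [|_]; first by rewrite inE => /fg[/mem_set -> ].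
by case: ifPn => //; rewrite inE => /g0.
Qed.

(** Raising [g] to [+oo] on [N] does not change its integral and turns the
    almost everywhere inequality into a pointwise one. *)
Lemma ae_le_lower_integral (N : set T) (f g : T -> \bar R) :
  measurable N -> mu N = 0 -> measurable_fun setT g ->
  (forall x, 0 <= f x) -> (forall x, 0 <= g x) ->
  (forall x, ~ N x -> f x <= g x) ->
  \int[mu]_x f x <= \int[mu]_x g x.
Proof.
move=> mN N0 mg f0 g0 fg.
pose g' x := if x \in N then +oo else g x.
have g'0 x : 0 <= g' x by rewrite /g'; case: ifP.
apply: (@le_trans _ _ (\int[mu]_x g' x)).
  apply: le_lower_integral => // x _; split=> //.
  by rewrite /g'; case: ifPn => [_|]; rewrite ?leey// notin_setE => /fg.
rewrite le_eqVlt; apply/orP; left; apply/eqP.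
apply: ge0_ae_eq_integral => //.
- apply: measurable_fun_ifT => //.
  apply: (measurable_fun_bool true); rewrite setTI.
  by rewrite (_ : _ @^-1` _ = N)//; apply/seteqP; split=> x; [exact: set_mem|exact: mem_set].
- exists N; split=> // x /= /not_implyP[_]; apply: contra_notP => Nx.
  by rewrite /g' memNset.
Qed.

(** The positive and the negative part of [f] are both below [H], and two
    numbers of [[0, c]] differ by at most [c]. *)
Lemma abse_integral_le (f H : T -> \bar R) (N : set T) :
  measurable N -> mu N = 0 -> measurable_fun setT H -> (forall x, 0 <= H x) ->
  (forall x, ~ N x -> `|f x| <= H x) -> `|\int[mu]_x f x| <= \int[mu]_x H x.
Proof.
move=> mN N0 mH H0 fH; rewrite integralE.
have p0 : 0 <= \int[mu]_x f^\+ x by exact: integral_ge0.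
have n0 : 0 <= \int[mu]_x f^\- x by exact: integral_ge0.
have : \int[mu]_x f^\+ x <= \int[mu]_x H x.
  apply: (ae_le_lower_integral mN) => // x /fH; apply: le_trans.
  by rewrite funeposE ge_max abse_ge0 lee_abs.
have : \int[mu]_x f^\- x <= \int[mu]_x H x.
  apply: (ae_le_lower_integral mN) => // x /fH; apply: le_trans.
  by rewrite funenegE ge_max abse_ge0 -abseN lee_abs.
move: p0 n0; move: (\int[mu]_x H x) (\int[mu]_x f^\+ x) (\int[mu]_x f^\- x).
case=> [h| |] [p| |] [n| |]//=; rewrite ?leey//.
by rewrite !lee_fin => p0 n0 nh ph; rewrite ler_norml; apply/andP; split; lra.
Qed.

(** It suffices to discard the exceptional sets of the countably many rays with
    rational endpoint. *)
Lemma completed_measurable_fun_ae (f : T -> R) :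
  completed_measurable_fun mu f ->
  exists N, [/\ measurable N, mu N = 0 &
    measurable_fun setT (fun x => if x \in N then 0%R else f x)].
Proof.
move=> cf.
have /choice[B HB] (q : rat) : exists BN : set T * set T,
    [/\ measurable BN.1, measurable BN.2, mu BN.2 = 0 &
     (f @^-1` `]ratr q, +oo[ `+` BN.1) `<=` BN.2].
  have [B mB [N [mN N0 BN]]] := cf `]ratr q, +oo[%classic (measurable_itv _).
  by exists (B, N).
pose N := \bigcup_q (B q).2.
have mN : measurable N by apply: bigcupT_measurable_rat => q; case: (HB q).
exists N; split => //.
  apply/eqP; rewrite eq_le measure_ge0 andbT.
  have -> : N = \bigcup_n (if unpickle n is Some q then (B q).2 else set0).
    apply/seteqP; split=> x.
      by move=> [q _ qx]; exists (pickle q); [exact: I|rewrite pickleK].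
    by move=> [n _]; case: unpickle => [q qx|//]; exists q.
  apply: le_trans (measure_sigma_subadditive _ _ _ (@subset_refl _ _)) _.
  - by move=> n; case: unpickle => // q; case: (HB q).
  - by apply: bigcupT_measurable => n; case: unpickle => // q; case: (HB q).
  rewrite eseries0// => n _ _; case: unpickle => [q|]; last exact: measure0.
  by case: (HB q).
have sideB q x : ~ N x -> (ratr q < f x)%R <-> (B q).1 x.
  move=> Nx; have [_ _ _ sub] := HB q; split=> h; apply: contrapT => h'; apply: Nx;
    exists q => //; apply: sub; [left|right] => //; split=> //=.
    by rewrite in_itv/= andbT.
  by rewrite in_itv/= andbT.
move=> _; apply: (measurability _ (RGenOInfty.measurableE R)) => //.
move=> _ [_ [r ->] <-]; rewrite setTI.
rewrite (_ : _ @^-1` _ = (if (r < 0)%R then N else set0) `|`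
    (~` N `&` \bigcup_q (if (r < ratr q)%R then (B q).1 else set0))); last first.
  apply/seteqP; split=> x /=; rewrite in_itv/= andbT.
    case: ifPn => [|xN]; first by rewrite inE => xN ->; left.
    move=> rf; right; rewrite notin_setE in xN; split=> //.
    have [q] := rat_in_itvoo rf; rewrite in_itv/= => /andP[rq qf].
    by exists q => //; rewrite rq; apply/sideB.
  move=> [|[Nx [q _]]]; first by case: ifP => // r0 /mem_set ->.
  rewrite memNset//; case: ifP => // rq /(sideB _ _ Nx).
  exact: lt_trans.
apply: measurableU; first by case: ifP.
apply: measurableI; first exact: measurableC.
by apply: bigcupT_measurable_rat => q; case: ifP => // _; case: (HB q).
Qed.

End lower_integral.

(** * Powers of a measure and shifted dyadic grids *)

Section tuple_measure_integral.
Context d (T : measurableType d) (R : realType).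
Variable mu : {sigma_finite_measure set T -> \bar R}.

Lemma emeasurable_prod d' (T' : measurableType d') (D : set T') n
    (h : 'I_n -> T' -> \bar R) : (forall i, measurable_fun D (h i)) ->
  measurable_fun D (fun x => \prod_(i < n) h i x).
Proof.
elim: n h => [|n IH] h mh.
  by under eq_fun do rewrite big_ord0; exact: measurable_cst.
under eq_fun do rewrite big_ord_recl.
by apply: emeasurable_funM => //; exact: (IH (fun i => h (lift ord0 i))).
Qed.

Lemma measurable_tnth_prod n (g : 'I_n -> T -> \bar R) :
  (forall i, measurable_fun setT (g i)) ->
  measurable_fun setT (fun x : n.-tuple T => \prod_(i < n) g i (tnth x i)).
Proof.
move=> mg; apply: emeasurable_prod => i.
by apply: (measurableT_comp (mg i)); exact: measurable_tnth.
Qed.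

Lemma integral_tuple_measure_prod n (g : 'I_n -> T -> \bar R) :
  (forall i, measurable_fun setT (g i)) -> (forall i x, 0 <= g i x) ->
  \int[tuple_measure mu n]_x \prod_(i < n) g i (tnth x i) =
  \prod_(i < n) \int[mu]_x g i x.
Proof.
elim: n g => [|n IH] g mg g0.
  rewrite big_ord0; under eq_integral do rewrite big_ord0.
  by rewrite (integral_cst (tuple_measure mu 0) measurableT) /= mul1e diracT.
have mP := measurable_tnth_prod mg.
rewrite /= /tuple_step (ge0_integral_pushforward (@measurable_tuple_pair _ T n))//=.
  2: by move=> y _; apply: prode_ge0.
rewrite preimage_setT.
have mP' : measurable_fun setT ((fun x : n.+1.-tuple T =>
    \prod_(i < n.+1) g i (tnth x i)) \o @tuple_pair _ T n).
  exact: (measurableT_comp mP (@measurable_tuple_pair _ T n)).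
rewrite fubini_tonelli1//; last by move=> x; exact: prode_ge0.
rewrite big_ord_recl -(IH (fun i => g (lift ord0 i)))//.
rewrite -ge0_integralZr//; last by apply: integral_ge0 => x _; exact: prode_ge0.
apply: eq_integral => x _; rewrite /fubini_F /=.
rewrite -ge0_integralZl//; last 2 first.
- exact: (measurable_tnth_prod (g := fun i => g (lift ord0 i))).
- by move=> y _; exact: prode_ge0.
apply: eq_integral => y _; rewrite big_ord_recl/= /tuple_pair/= tnth0.
by congr (_ * _); apply: eq_bigr => i _; rewrite tnthS.
Qed.

Lemma tuple_measure_box0 n (A : 'I_n -> set T) i : (forall i, measurable (A i)) ->
  mu (A i) = 0 -> tuple_measure mu n [set x | forall i, A i (tnth x i)] = 0.
Proof. by move=> mA A0; rewrite tuple_measure_box// (bigD1 i)//= A0 mul0e. Qed.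

Lemma measurable_box n (A : 'I_n -> set T) : (forall i, measurable (A i)) ->
  measurable [set x : n.-tuple T | forall i, A i (tnth x i)].
Proof.
move=> mA; rewrite (_ : mkset _ = \bigcap_(i in [set: 'I_n])
    ((fun x : n.-tuple T => tnth x i) @^-1` A i)).
  apply: fin_bigcap_measurable => // i _.
  by rewrite -[X in measurable X]setTI; exact: measurable_tnth.
by apply/seteqP; split=> x /= xA i; [move=> _|]; exact: xA.
Qed.

End tuple_measure_integral.

Section shifted_grids.
Context {R : realType} (n : nat).
Implicit Types (kappa : int) (t : {ffun 'I_n -> bool}) (x y : Rn R n).

(** Position of [z] in the grid of mesh [2 ^ kappa], in units of the mesh.  The
    shift by a third has the sign of the parity of [kappa]: this makes the
    shifted grids of consecutive scales nested. *)
Definition grid_coord (b : bool) kappa (z : R) : R :=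
  (z / 2 ^ kappa - b%:R * (-1) ^ kappa / 3)%R.

Definition grid t kappa x : n.-tuple int :=
  [tuple Num.floor (grid_coord (t i) kappa (tnth x i)) | i < n].

Let two_gt0 kappa : (0 < 2 ^ kappa :> R)%R. Proof. exact: exprz_gt0. Qed.

Lemma signz_odd kappa : ((-1) ^ kappa = (-1) ^+ odd `|kappa|%N :> R)%R.
Proof.
case: kappa => k; first by rewrite -exprnP signr_odd.
by rewrite NegzE -exprnN -exprVn invrN1 abszN signr_odd.
Qed.

(** [1 / 3 + 2 / 3] is an integer, so the shift of the coarser grid is a point of
    the finer one. *)
Lemma grid_coordS b kappa z : grid_coord b (kappa + 1) z =
  ((grid_coord b kappa z + (b%:R * (-1) ^+ odd `|kappa|%N)%:~R) / 2)%R.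
Proof.
rewrite /grid_coord !exprzDr ?expr1z ?unitrN1 ?unitfE// signz_odd.
rewrite invfM intrM; have := two_gt0 kappa; set p := (2 ^ kappa)%R => p0.
have -> : ((-1) ^+ odd `|kappa|%N)%:~R = ((-1) ^+ odd `|kappa|%N : R)%R.
  by rewrite rmorphXn/= rmorphN1.
rewrite (_ : (b%:R : int)%:~R = b%:R)%R; last by case: b.
set e := (_ ^+ odd _)%R; by field; rewrite gt_eqF.
Qed.

Lemma floor_half_int (z z' : R) (e : int) : Num.floor z = Num.floor z' ->
  Num.floor ((z + e%:~R) / 2)%R = Num.floor ((z' + e%:~R) / 2)%R.
Proof.
move=> zz'; set q := Num.floor ((z' + e%:~R) / 2)%R.
have /andP[ql qr] : (q%:~R <= (z' + e%:~R) / 2 < (q + 1)%:~R)%R.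
  by rewrite /q floor_itv.
have /andP[fl fr] : ((Num.floor z)%:~R <= z < (Num.floor z + 1)%:~R)%R by exact: floor_itv.
have : (2 * q - e <= Num.floor z')%R.
  rewrite floor_ge_int intrD intrM rmorphN/=; lra.
have : (Num.floor z' < 2 * (q + 1) - e)%R.
  rewrite ltNge floor_ge_int -ltNge intrD intrM rmorphN/= ; lra.
rewrite -zz' => h1 h2; apply: floor_def.
have {}h1 : ((Num.floor z + 1)%:~R <= (2 * (q + 1) - e)%:~R :> R)%R.
  by rewrite ler_int; lia.
have {}h2 : ((2 * q - e)%:~R <= (Num.floor z)%:~R :> R)%R by rewrite ler_int.
move: h1 h2 fl fr ql qr; rewrite !(intrD, intrM, rmorphN)/= => *.
by apply/andP; split; lra.
Qed.

Lemma grid_coarse t kappa x y : grid t kappa x = grid t kappa y ->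
  grid t (kappa + 1) x = grid t (kappa + 1) y.
Proof.
move=> xy; apply: eq_from_tnth => i; rewrite !tnth_mktuple !grid_coordS.
have := congr1 (fun u => tnth u i) xy; rewrite !tnth_mktuple.
exact: floor_half_int.
Qed.

(** Points of the unshifted and of the shifted grid are at least a third of the
    mesh apart, so an interval of length a quarter of the mesh cannot meet both. *)
Lemma third_trick kappa z : exists b, forall z', (`|z - z'| <= 2 ^ kappa / 8)%R ->
  Num.floor (grid_coord b kappa z') = Num.floor (grid_coord b kappa z).
Proof.
have p0 := two_gt0 kappa.
pose q (r : R) : R := (r / 2 ^ kappa)%R.
have close z' : (`|z - z'| <= 2 ^ kappa / 8)%R -> (q z - 1 / 8 <= q z' <= q z + 1 / 8)%R.
  move=> zz'; have : (`|q z - q z'| <= 1 / 8)%R.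
    by rewrite /q -mulrBl normrM [X in (_ * X)%R]gtr0_norm ?invr_gt0// ler_pdivrMr//; lra.
  by rewrite ler_norml => /andP[? ?]; apply/andP; split; lra.
have [e|ne] := eqVneq (Num.floor (q z - 1 / 8)%R) (Num.floor (q z + 1 / 8)%R).
  have main r : (q z - 1 / 8 <= q r <= q z + 1 / 8)%R ->
      Num.floor (q r) = Num.floor (q z + 1 / 8)%R.
    move=> /andP[h1 h2]; apply/le_anti.
    by rewrite (le_floor h2)/= -e le_floor.
  exists false => z' /close h; rewrite /grid_coord !mul0r !subr0.
  by rewrite !main//; apply/andP; split; lra.
set M := Num.floor (q z + 1 / 8)%R.
have M1 : (M%:~R <= q z + 1 / 8)%R by exact: floor_le.
have M2 : (q z - 1 / 8 < M%:~R)%R.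
  rewrite ltNge -floor_ge_int; apply: contra ne => h.
  apply/eqP/le_anti; rewrite h andbT le_floor//; lra.
exists true => z' /close; rewrite /grid_coord -/(q z) -/(q z') => /andP[h1 h2].
rewrite signz_odd mul1r; case: (odd _); rewrite /= ?expr1 ?expr0.
  by transitivity M; [|symmetry]; apply: floor_def;
    rewrite intrD; apply/andP; split; lra.
by transitivity (M - 1)%R; [|symmetry]; apply: floor_def;
  rewrite !intrD rmorphN1; apply/andP; split; lra.
Qed.

Lemma grid_cover kappa x : exists t, forall y,
  (forall i, `|tnth x i - tnth y i| <= 2 ^ kappa / 8)%R ->
  grid t kappa y = grid t kappa x.
Proof.
have /choice[b hb] : forall i, exists b, forall z',
    (`|tnth x i - z'| <= 2 ^ kappa / 8)%R ->
    Num.floor (grid_coord b kappa z') = Num.floor (grid_coord b kappa (tnth x i)).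
  by move=> i; exact: third_trick.
exists [ffun i => b i] => y yx; apply: eq_from_tnth => i.
by rewrite !tnth_mktuple ffunE hb.
Qed.

End shifted_grids.

(** * Cells, cubes and Luxemburg norms *)

Section boxes.
Context {R : realType} (n : nat).

Lemma measurable_itv_box (I : 'I_n -> interval R) :
  measurable [set y : Rn R n | forall i, [set` I i] (tnth y i)].
Proof.
apply: (@measurable_box _ (measurableTypeR R) n (fun i => [set` I i])) => i.
exact: measurable_itv.
Qed.

Lemma leb_itv_box (I : 'I_n -> interval R) :
  leb n [set y : Rn R n | forall i, [set` I i] (tnth y i)] =
  \prod_(i < n) lebesgue_measure ([set` I i] : set R).
Proof.
apply: (tuple_measure_box (@lebesgue_measure R) (A := fun i => [set` I i])) => i.
exact: measurable_itv.
Qed.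

Lemma cube_itv_box (q : Rn R n * R) : cube q =
  [set y | forall i, [set` `[tnth q.1 i, (tnth q.1 i + q.2)%R] ] (tnth y i)].
Proof.
apply/seteqP; split=> y /= h i; have := h i; rewrite in_itv/=.
  by move=> [-> ->].
by move=> /andP[].
Qed.

Lemma measurable_cube (q : Rn R n * R) : measurable (cube q).
Proof.
by rewrite cube_itv_box; exact: (measurable_itv_box (fun i => `[_, _])).
Qed.

End boxes.

Section grid_cells.
Context {R : realType} (n : nat).
Implicit Types (kappa : int) (t : {ffun 'I_n -> bool}) (x y : Rn R n).

Definition grid_corner t kappa (z : n.-tuple int) : Rn R n :=
  [tuple (2 ^ kappa * ((tnth z i)%:~R + (t i)%:R * (-1) ^ kappa / 3))%R | i < n].

Let two_gt0 kappa : (0 < 2 ^ kappa :> R)%R. Proof. exact: exprz_gt0. Qed.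

Lemma grid_fiberE t kappa z : grid t kappa @^-1` [set z] =
  [set y : Rn R n | forall i, `[tnth (grid_corner t kappa z) i,
     (tnth (grid_corner t kappa z) i + 2 ^ kappa)%R[%classic (tnth y i)].
Proof.
have p0 := two_gt0 kappa.
have E y i : `[tnth (grid_corner t kappa z) i,
     (tnth (grid_corner t kappa z) i + 2 ^ kappa)%R[%classic (tnth y i) <->
    Num.floor (grid_coord (t i) kappa (tnth y i)) = tnth z i.
  rewrite tnth_mktuple /= in_itv/= /grid_coord.
  set o := (_ / 3)%R.
  have -> : (2 ^ kappa * ((tnth z i)%:~R + o) <= tnth y i)%R =
      ((tnth z i)%:~R <= tnth y i / 2 ^ kappa - o)%R.
    by rewrite lerBrDr ler_pdivlMr// mulrC.
  have -> : (tnth y i < 2 ^ kappa * ((tnth z i)%:~R + o) + 2 ^ kappa)%R =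
      (tnth y i / 2 ^ kappa - o < (tnth z i + 1)%:~R)%R.
    rewrite ltrBlDr ltr_pdivrMr// intrD; congr (_ < _)%R.
    by rewrite mulrDl mulrC; ring.
  by split=> [/floor_def//|<-]; exact: floor_itv.
apply/seteqP; split=> y /=.
  by move=> yz i; apply/E; rewrite -yz tnth_mktuple.
by move=> h; apply: eq_from_tnth => i; rewrite tnth_mktuple; apply/E; exact: h.
Qed.

Lemma measurable_grid_fiber t kappa z : measurable (grid t kappa @^-1` [set z] : set (Rn R n)).
Proof.
rewrite grid_fiberE.
exact: (measurable_itv_box (fun i => `[tnth (grid_corner t kappa z) i,
  (tnth (grid_corner t kappa z) i + 2 ^ kappa)%R[)).
Qed.

Lemma leb_grid_fiber t kappa z :
  leb n (grid t kappa @^-1` [set z]) = ((2 ^ kappa) ^+ n : R)%R%:E.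
Proof.
rewrite grid_fiberE (leb_itv_box (fun i => `[tnth (grid_corner t kappa z) i,
  (tnth (grid_corner t kappa z) i + 2 ^ kappa)%R[)).
rewrite -[RHS](_ : \prod_(i < n) (2 ^ kappa : R)%:E = _); last first.
  by rewrite prodEFin prodr_const card_ord.
apply: eq_bigr => i _; rewrite lebesgue_measure_itv/= lte_fin ltrDl two_gt0.
by rewrite -EFinD addrAC subrr add0r.
Qed.

Lemma leb_cube (q : Rn R n * R) : (0 < q.2)%R -> leb n (cube q) = (q.2 ^+ n)%:E.
Proof.
move=> q0; rewrite cube_itv_box.
rewrite (leb_itv_box (fun i => `[tnth q.1 i, (tnth q.1 i + q.2)%R])).
rewrite -[RHS](_ : \prod_(i < n) (q.2)%:E = _); last first.
  by rewrite prodEFin prodr_const card_ord.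
apply: eq_bigr => i _; rewrite lebesgue_measure_itv/= lte_fin ltrDl q0.
by rewrite -EFinD addrAC subrr add0r.
Qed.

Definition grid_cube t kappa x : Rn R n * R :=
  (grid_corner t kappa (grid t kappa x), (2 ^ kappa)%R).

Lemma grid_fiber_sub_cube t kappa x :
  grid t kappa @^-1` [set grid t kappa x] `<=` cube (grid_cube t kappa x).
Proof.
rewrite grid_fiberE => y /= h i; have := h i; rewrite in_itv/= => /andP[h1 h2].
by split=> //; exact: ltW.
Qed.

Lemma grid_cube_at t kappa x y : grid t kappa x = grid t kappa y ->
  cubes_at y (grid_cube t kappa x).
Proof.
move=> xy; split; first exact: two_gt0.
by apply: grid_fiber_sub_cube; rewrite /= xy.
Qed.

Lemma leb_grid_cube t kappa x :
  fine (leb n (cube (grid_cube t kappa x))) = ((2 ^ kappa) ^+ n)%R.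
Proof. by rewrite leb_cube//; exact: two_gt0. Qed.

End grid_cells.

Section luxemburg_facts.
Context {R : realType} (n : nat).

Lemma avg_le (q : Rn R n * R) (g h : Rn R n -> \bar R) :
  (forall x, 0 <= g x) -> (forall x, g x <= h x) -> avg q g <= avg q h.
Proof.
move=> g0 gh; apply: lee_wpmul2l; first by rewrite lee_fin invr_ge0 fine_ge0.
apply: le_lower_integral => // x _; exact: le_trans (g0 x) (gh x).
Qed.

Variable delta : R.
Hypothesis delta_gt0 : (0 < delta)%R.

Lemma luxemburg_ge0 (g : Rn R n -> R) q : 0 <= luxemburg (LlogL delta) g q.
Proof.
by apply: le_ereal_inf_tmp => _ [lam [lam0 _] <-]; rewrite lee_fin ltW.
Qed.

Lemma le_luxemburg (g h : Rn R n -> R) q : (forall x, 0 <= g x <= h x)%R ->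
  luxemburg (LlogL delta) g q <= luxemburg (LlogL delta) h q.
Proof.
move=> gh; apply: le_ereal_inf_tmp => _ [lam [lam0 hl] <-].
apply: ereal_inf_lbound; exists lam; [split; [exact: lam0|]|by []].
apply: le_trans hl; apply: avg_le => x.
  by rewrite lee_fin LlogL_ge0// divr_ge0// ltW.
have /andP[g0 gh'] := gh x; have h0 := le_trans g0 gh'.
rewrite lee_fin; apply: le_LlogL => //; rewrite (ger0_norm g0) (ger0_norm h0).
by rewrite divr_ge0 ?(ltW lam0)//= ler_pM2r ?invr_gt0.
Qed.

Lemma luxemburg_le_bound (g : Rn R n -> R) q (M : R) : (0 < M)%R -> (0 < q.2)%R ->
  (forall x, `|g x| <= M)%R -> luxemburg (LlogL delta) g q <= M%:E.
Proof.
move=> M0 q0 gM; apply: ereal_inf_lbound; exists M; [split; [exact: M0|]|by []].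
have mq := measurable_cube q.
apply: (@le_trans _ _ (avg q (cst 1))).
  apply: avg_le => x; first by rewrite lee_fin LlogL_ge0// divr_ge0// ltW.
  by rewrite lee_fin LlogL_le1// divr_ge0 ?(ltW M0)//= ler_pdivrMr// mul1r.
rewrite /avg integral_cst// mul1e (leb_cube q0) [X in _ * X](leb_cube q0) /=.
rewrite -EFinM lee_fin.
by rewrite mulVf// gt_eqF// exprn_gt0.
Qed.

(** The bound of [integral_thin_le] holds for every admissible [lam], hence for
    their infimum. *)
Lemma integral_luxemburg_thin_le (u : Rn R n -> R) t (kappa : int) (x : Rn R n)
    (E : set (Rn R n)) L (P := [set y | grid t kappa y = grid t kappa x]) :
  measurable_fun setT u -> (forall y, 0 <= u y)%R -> measurable E ->
  leb n (P `&` E) <= (2^-1 ^+ L)%:E * leb n P ->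
  \int[leb n]_(y in P `&` E) (u y)%:E <=
  (thinness delta L)%:E * leb n P *
    luxemburg (LlogL delta) u (grid_cube t kappa x).
Proof.
move=> u_meas u0 mE thinE.
have mC : measurable P by exact: measurable_grid_fiber.
have lC : leb n P = ((2 ^ kappa) ^+ n : R)%R%:E by exact: leb_grid_fiber.
have s0 : (0 < (2 ^ kappa) ^+ n :> R)%R by rewrite exprn_gt0// exprz_gt0.
have c0 : (0 < thinness delta L * (2 ^ kappa) ^+ n)%R.
  by rewrite mulr_gt0// thinness_gt0.
rewrite lC -EFinM -lee_pdivrMl//; apply: le_ereal_inf_tmp => _ [lam [lam0 av] <-].
rewrite lee_pdivrMl// -EFinM.
apply: (integral_thin_le delta_gt0) => //.
apply: le_trans av; rewrite /avg leb_grid_cube.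
apply: lee_wpmul2l; first by rewrite lee_fin invr_ge0 ltW.
apply: le_lower_integral => y.
- by move=> _; rewrite lee_fin LlogL_ge0// divr_ge0// ltW.
- by move=> _; rewrite lee_fin LlogL_ge0// divr_ge0// ltW.
move=> yx; split; first exact: grid_fiber_sub_cube.
by rewrite ger0_norm.
Qed.

End luxemburg_facts.

(** * The weak-type bound on one shifted grid *)

Lemma esups_ubound (R : realType) (h : nat -> \bar R) k : h k <= esups h 0%N.
Proof. by apply: ereal_sup_ubound; exists k. Qed.

Lemma esups_le (R : realType) (h : nat -> \bar R) M :
  (forall k, h k <= M) -> esups h 0%N <= M.
Proof. by move=> hM; apply: ge_ereal_sup => _ [k _ <-]. Qed.

(** When a factor vanishes, letting the corresponding [theta j] tend to 0 makes
    [X] nonpositive.  This handles the functions whose weighted norm is zero, by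
    which one cannot divide. *)
Lemma le_prod_of_perturbed (R : realFieldType) m (W : 'I_m -> R) (c X : R) :
  (0 < c)%R -> (forall i, 0 <= W i)%R ->
  (forall theta : 'I_m -> R, (forall i, W i <= theta i /\ 0 < theta i)%R ->
    X <= c * \prod_(i < m) theta i)%R ->
  (X <= c * \prod_(i < m) W i)%R.
Proof.
move=> c0 W0 H; have [[j Wj]|Wn0] := pselect (exists j, W j = 0%R); last first.
  apply: H => i; split=> //; rewrite lt_neqAle W0 andbT eq_sym.
  by apply/eqP => Wi; apply: Wn0; exists i.
rewrite [X in (_ <= _ * X)%R](bigD1 j)//= Wj mul0r mulr0.
pose P : R := (c * \prod_(i < m | i != j) (W i + 1))%R.
have P0 : (0 < P)%R.
  by rewrite mulr_gt0// prodr_gt0// => i _; rewrite ltr_wpDl.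
rewrite leNgt; apply/negP => X0.
have := H (fun i => if i == j then X / (2 * P) else W i + 1)%R.
have -> : (c * \prod_(i < m) (if i == j then X / (2 * P) else W i + 1) = X / 2)%R.
  rewrite (bigD1 j)//= eqxx (eq_bigr (fun i => W i + 1)%R).
    rewrite /P; field; apply/andP; split; rewrite gt_eqF//.
    by rewrite prodr_gt0// => i _; rewrite ltr_wpDl.
  by move=> i /negbTE ->.
move=> h; have : (X <= X / 2)%R.
  apply: h => i; case: eqP => [->|_].
    by rewrite Wj; split; [apply: ltW|]; rewrite divr_gt0// mulr_gt0.
  by rewrite lerDl ler01 ltr_wpDl.
by lra.
Qed.

Section grid_weak_type.
Context {R : realType} (n m : nat).
Hypothesis m_gt0 : (0 < m)%N.
Variables (t : {ffun 'I_n -> bool}) (kap0 : int) (delta : R).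
Hypothesis delta_gt0 : (0 < delta)%R.

Definition scale k : int := (k%:Z + kap0)%R.
Definition grid_at k (x : Rn R n) := grid t (scale k) x.
Definition side k : R := (2 ^ scale k)%R.

Let side_gt0 k : (0 < side k)%R. Proof. exact: exprz_gt0. Qed.

Let vol_gt0 k : (0 < side k ^+ n)%R. Proof. exact: exprn_gt0. Qed.

Let mgrid k z : measurable (grid_at k @^-1` [set z]).
Proof. exact: measurable_grid_fiber. Qed.

Let grid_atS k x y : grid_at k x = grid_at k y -> grid_at k.+1 x = grid_at k.+1 y.
Proof.
move=> /grid_coarse; rewrite /grid_at (_ : scale k.+1 = scale k + 1)%R//.
by rewrite /scale -addn1 PoszD addrAC.
Qed.

Let leb_cell k x : leb n (cell grid_at k x) = (side k ^+ n)%:E.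
Proof. exact: leb_grid_fiber. Qed.

Variables (K : nat) (a : nat -> R).
Hypothesis a_ge0 : forall k, (0 <= a k)%R.
Hypothesis a_eq0 : forall k, (K < k)%N -> a k = 0%R.

Let beta k : R := ((\sum_(j < k.+1) a j) `^ m%:R^-1)%R.

Let sum_ge0 k : (0 <= \sum_(j < k.+1) a j)%R. Proof. exact: sumr_ge0. Qed.

Let root_exp (r : R) : (0 <= r)%R -> ((r `^ m%:R^-1) ^+ m = r)%R.
Proof.
move=> r0; rewrite -powR_mulrn ?powR_ge0// -powRrM mulVf ?powRr1//.
by rewrite pnatr_eq0 -lt0n.
Qed.

Let sum_le_top k : (\sum_(j < k.+1) a j <= \sum_(j < K.+1) a j)%R.
Proof.
have [kK|Kk] := leqP k K.
  by rewrite -(subnKC kK) -addSn big_split_ord/= lerDl sumr_ge0.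
rewrite -(subnKC (ltnW Kk)) -addSn big_split_ord/= gerDl.
by rewrite big1// => i _; rewrite a_eq0//= addSn ltnS leq_addr.
Qed.

(** Dyadic counterpart of [M_LlogL]; unlike the latter it is a countable supremum
    of functions constant on cells, hence clearly Borel. *)
Definition grid_LlogL (u : Rn R n -> R) (x : Rn R n) : \bar R :=
  esups (fun k => luxemburg (LlogL delta) u (grid_cube t (scale k) x)) 0%N.

(** Dyadic counterpart of [M_Phi], with [Phi] replaced by the partial sums of [a]. *)
Definition grid_fractional (v : Rn R n -> \bar R) (x : Rn R n) : \bar R :=
  esups (fun k => (beta k / side k ^+ n)%:E *
    \int[leb n]_(z in cell grid_at k x) v z) 0%N.

Lemma measurable_grid_LlogL u : measurable_fun setT (grid_LlogL u).
Proof.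
apply: measurable_fun_esups => k.
apply: (cellwise_measurable (c := grid_at) mgrid (k := k)) => x y xy.
by rewrite /grid_cube /=; congr luxemburg; congr (_, _); rewrite [grid t _ x]xy.
Qed.

Lemma measurable_grid_fractional v : measurable_fun setT (grid_fractional v).
Proof.
apply: measurable_fun_esups => k.
apply: (cellwise_measurable (c := grid_at) mgrid (k := k)) => x y xy.
by rewrite (cell_eq xy).
Qed.

Lemma grid_LlogL_ge0 u x : 0 <= grid_LlogL u x.
Proof. exact: le_trans (luxemburg_ge0 _ _ _) (esups_ubound _ 0%N). Qed.

Lemma grid_fractional_ge0 v x : (forall y, 0 <= v y) -> 0 <= grid_fractional v x.
Proof.
move=> v0; apply: le_trans (esups_ubound _ 0%N).
by rewrite mule_ge0 ?integral_ge0// lee_fin divr_ge0 ?powR_ge0// ltW.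
Qed.

Lemma grid_LlogL_le (u u0 : Rn R n -> R) x : (forall y, 0 <= u y <= u0 y)%R ->
  grid_LlogL u x <= M_LlogL delta u0 x.
Proof.
move=> uu0; apply: esups_le => k.
apply: (le_trans (le_luxemburg delta_gt0 _ uu0)).
by apply: ereal_sup_ubound; exists (grid_cube t (scale k) x) => //; exact: grid_cube_at.
Qed.

Lemma grid_fractional_le (Phi : R -> \bar R) (v g : Rn R n -> \bar R) x :
  (forall k, (\sum_(j < k.+1) a j)%:E <= Phi (side k)) ->
  (forall y, 0 <= v y <= g y) -> grid_fractional v x <= M_Phi m Phi g x.
Proof.
move=> aPhi vg; apply: esups_le => k.
pose q := grid_cube t (scale k) x.
apply: (@le_trans _ _ (Phi q.2 `^ m%:R^-1 * avg q (fun z => `|g z|))); last first.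
  by apply: ereal_sup_ubound; exists q => //; exact: grid_cube_at.
rewrite EFinM -muleA; apply: lee_pmul.
- by rewrite lee_fin powR_ge0.
- rewrite mule_ge0//; first by rewrite lee_fin invr_ge0 ltW.
  by apply: integral_ge0 => y _; case/andP: (vg y).
- rewrite /beta -poweR_EFin gt0_ler_poweR ?invr_ge0// ?in_itv/= ?leey//.
    by rewrite andbT lee_fin sum_ge0.
  by rewrite andbT; apply: le_trans (aPhi k); rewrite lee_fin sum_ge0.
rewrite /avg (leb_grid_cube t (scale k) x).
apply: lee_wpmul2l; first by rewrite lee_fin invr_ge0 ltW.
apply: le_lower_integral => y.
- by move=> _; case/andP: (vg y).
- by move=> _; exact: abse_ge0.
move=> yx; split; first exact: grid_fiber_sub_cube.
by have /andP[_ h] := vg y; apply: (le_trans h); exact: lee_abs.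
Qed.

Lemma grid_LlogL_le_bound u M x : (0 < M)%R -> (forall y, `|u y| <= M)%R ->
  grid_LlogL u x <= M%:E.
Proof.
move=> M0 uM; apply: esups_le => k; apply: luxemburg_le_bound => //.
exact: side_gt0.
Qed.

Lemma grid_fractional_le_bound v (M : R) x : (0 <= M)%R -> measurable_fun setT v ->
  (forall y, 0 <= v y <= M%:E) -> grid_fractional v x <= (beta K * M)%:E.
Proof.
move=> M0 mv vM; apply: esups_le => k.
have b0 : (0 <= beta k)%R by exact: powR_ge0.
apply: (@le_trans _ _ ((beta k / side k ^+ n)%:E * (M%:E * (side k ^+ n)%:E))).
  apply: lee_wpmul2l; first by rewrite lee_fin divr_ge0// ltW.
  have mC := measurable_cell mgrid k x.
  rewrite -(leb_cell k x) -integral_cst//; apply: ge0_le_integral => //.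
  - by move=> y _; case/andP: (vM y).
  - exact: measurable_funTS.
  - by move=> y _; case/andP: (vM y).
rewrite -!EFinM lee_fin.
rewrite (_ : beta k / side k ^+ n * (M * side k ^+ n) = beta k * M)%R; last first.
  have := vol_gt0 k; move: (side k ^+ n)%R (beta k) => V b' V0.
  by field; rewrite gt_eqF.
apply: ler_wpM2r => //.
by apply: ge0_ler_powR; rewrite ?invr_ge0 ?nnegrE ?sum_ge0 ?sum_le_top.
Qed.

Variables (f u : 'I_m -> Rn R n -> R) (M : R).
Hypothesis mf : forall i, measurable_fun setT (f i).
Hypothesis f_ge0 : forall i x, (0 <= f i x)%R.
Hypothesis f_fin : forall i, \int[leb n]_x (f i x)%:E < +oo.
Hypothesis u_meas : forall i, measurable_fun setT (u i).
Hypothesis u_ge0 : forall i x, (0 <= u i x)%R.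
Hypothesis M_gt0 : (0 < M)%R.
Hypothesis u_le : forall i x, (u i x <= M)%R.

Variable Ctau : R.
Hypothesis Ctau_gt0 : (0 < Ctau)%R.
Hypothesis Ctau_le : forall J,
  (2 * thinness delta 0 + 8 * \sum_(j < J) thinness delta (2 ^ j.+1)%N <= Ctau)%R.

Let w i := grid_fractional (grid_LlogL (u i)).

Let S x : R := (\sum_(k < K.+1)
  a k * prod_mean (leb n) grid_at (fun k => side k ^+ n) f k x)%R.

Let U x : R := (\prod_(i < m) u i x `^ m%:R^-1)%R.

Let w_ge0 i x : 0 <= w i x.
Proof. by apply: grid_fractional_ge0 => y; exact: grid_LlogL_ge0. Qed.

Let mw i : measurable_fun setT (w i). Proof. exact: measurable_grid_fractional. Qed.

Let mEf i D : measurable_fun D (fun x => (f i x)%:E).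
Proof. exact/measurable_funTS/measurable_EFinP. Qed.

Let fw_ge0 i x : 0 <= (f i x)%:E * w i x.
Proof. by rewrite mule_ge0 ?lee_fin. Qed.

Let mfw i : measurable_fun setT (fun x => (f i x)%:E * w i x).
Proof. exact: emeasurable_funM. Qed.

Let f_fin_cell i k x : \int[leb n]_(y in cell grid_at k x) (f i y)%:E < +oo.
Proof.
apply: le_lt_trans (f_fin i); apply: ge0_subset_integral => //.
- exact: (measurable_cell mgrid).
- by move=> y _; rewrite lee_fin.
Qed.

Lemma fw_fin i : \int[leb n]_x ((f i x)%:E * w i x) < +oo.
Proof.
apply: (@le_lt_trans _ _ (\int[leb n]_x ((f i x)%:E * (beta K * M)%:E))).
  apply: ge0_le_integral => //.
    exact: emeasurable_funM.
  move=> x _; apply: lee_wpmul2l; first by rewrite lee_fin.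
  apply: grid_fractional_le_bound; [exact: ltW|exact: measurable_grid_LlogL|].
  move=> y; rewrite grid_LlogL_ge0 /= grid_LlogL_le_bound// => z.
  by rewrite ger0_norm.
have c0 : (0 <= beta K * M)%R by rewrite mulr_ge0 ?powR_ge0// ltW.
have If0 : 0 <= \int[leb n]_x (f i x)%:E.
  by apply: integral_ge0 => x _; rewrite lee_fin.
rewrite ge0_integralZr//; last by move=> x _; rewrite lee_fin.
apply: lte_mul_pinfty => //; last by rewrite ltry.
by rewrite ge0_fin_numE ?f_fin.
Qed.

Let W i : R := fine (\int[leb n]_x ((f i x)%:E * w i x)).

Let WE i : \int[leb n]_x ((f i x)%:E * w i x) = (W i)%:E.
Proof. by rewrite /W fineK// ge0_fin_numE ?fw_fin// integral_ge0. Qed.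

Let mU : measurable_fun setT U.
Proof.
apply: measurable_prod => i _.
exact: (measurableT_comp (measurable_powR _) (u_meas i)).
Qed.

Let U_ge0 x : (0 <= U x)%R.
Proof. by apply: prodr_ge0 => i _; exact: powR_ge0. Qed.

(** Multiplying [f i] by [rho / theta i] makes all the weighted norms at most [rho]
    and the level equal to [6 * 2 ^ m]. *)
Lemma grid_weak_type_scaled (theta : 'I_m -> R) (lam rho : R) :
  (forall i, W i <= theta i /\ 0 < theta i)%R -> (0 < lam)%R -> (0 <= rho)%R ->
  (rho ^+ m = 6 * 2 ^+ m * (\prod_(i < m) theta i) / lam)%R ->
  \int[leb n]_(x in [set x | (lam < S x)%R]) (U x)%:E <= (Ctau * rho)%:E.
Proof.
move=> Wtheta lam0 rho0 rhoE.
have th0 i : (0 < theta i)%R by case: (Wtheta i).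
pose g i x : R := (rho / theta i * f i x)%R.
have r0 i : (0 <= rho / theta i)%R by rewrite divr_ge0// ltW.
have mg i : measurable_fun setT (g i) by exact: measurable_funM.
have g0 i x : (0 <= g i x)%R by rewrite mulr_ge0.
have Zg i (D : set (Rn R n)) : measurable D ->
    \int[leb n]_(y in D) (g i y)%:E = (rho / theta i)%:E * \int[leb n]_(y in D) (f i y)%:E.
  move=> mD; rewrite -ge0_integralZl ?lee_fin//.
  by move=> y _; rewrite lee_fin.
have g_fin i k x : \int[leb n]_(y in cell grid_at k x) (g i y)%:E < +oo.
  rewrite Zg; last exact: (measurable_cell mgrid).
  rewrite lte_mul_pinfty ?lee_fin//.
have gE k x : prod_mean (leb n) grid_at (fun k => side k ^+ n)%R g k x =
    (6 * 2 ^+ m / lam * prod_mean (leb n) grid_at (fun k => side k ^+ n)%R f k x)%R.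
  rewrite /prod_mean.
  transitivity (\prod_(i < m) (rho / theta i *
      mean (leb n) grid_at (fun k => side k ^+ n)%R f i k x))%R.
    apply: eq_bigr => i _; rewrite /mean Zg; last exact: (measurable_cell mgrid).
    rewrite fineM//; first by rewrite mulrA.
    rewrite ge0_fin_numE ?f_fin_cell// integral_ge0// => y _.
    by rewrite lee_fin.
  rewrite big_split/= prodf_div prodr_const card_ord rhoE; congr (_ * _)%R.
  have : (0 < \prod_(i < m) theta i)%R by exact: prodr_gt0.
  by set P := (\prod_(i < m) theta i)%R => P0; field; rewrite !gt_eqF.
have -> : [set x | (lam < S x)%R] = [set x | (6 * 2 ^+ m < \sum_(k < K.+1) a k *
    prod_mean (leb n) grid_at (fun k => side k ^+ n) g k x)%R].
  apply/seteqP; have e x : (lam < S x)%R = (6 * 2 ^+ m < \sum_(k < K.+1) a k *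
      prod_mean (leb n) grid_at (fun k => side k ^+ n) g k x)%R.
    under eq_bigr do rewrite gE mulrCA.
    rewrite -mulr_sumr -/(S x) mulrAC ltr_pdivlMr// ltr_pM2l//.
  by split=> x /=; rewrite e.
have betaE k : (beta k ^+ m = \sum_(j < k.+1) a j)%R by exact: root_exp.
have UE x : (U x ^+ m = \prod_(i < m) u i x)%R.
  by rewrite -prodrXl; apply: eq_bigr => i _; rewrite root_exp.
have core := weak_type_normalized mgrid grid_atS vol_gt0 leb_cell m_gt0 mg g0
  g_fin K a_ge0 (fun k => powR_ge0 _ _) betaE u_meas u_ge0 mU U_ge0 UE.
apply: (core (fun i k x => luxemburg (LlogL delta) (u i) (grid_cube t (scale k) x))
  (fun i => grid_LlogL (u i)) w (thinness delta)) => //.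
- by move=> i; exact: measurable_grid_LlogL.
- by move=> L; exact/ltW/thinness_gt0.
- by move=> i k x; exact: luxemburg_ge0.
- move=> i k x y xy; rewrite (_ : grid_cube t (scale k) x = grid_cube t (scale k) y).
    exact: (esups_ubound (fun k => luxemburg (LlogL delta) (u i) (grid_cube t (scale k) y)) k).
  by rewrite /grid_cube [grid t _ x]xy.
- by move=> i L k x E mE thinE;
  exact: (integral_luxemburg_thin_le delta_gt0 (u_meas i) (u_ge0 i) mE thinE).
- move=> i k x y xy; rewrite (cell_eq xy).
  exact: (esups_ubound (fun k => (beta k / side k ^+ n)%:E *
    \int[leb n]_(z in cell grid_at k y) grid_LlogL (u i) z) k).
move=> i; rewrite (_ : \int[leb n]_x _ = (rho / theta i)%:E *
    \int[leb n]_x ((f i x)%:E * w i x)).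
  rewrite WE -EFinM lee_fin mulrAC ler_pdivrMr// ler_wpM2l//.
  by case: (Wtheta i).
rewrite -ge0_integralZl ?lee_fin//; apply: eq_integral => x _.
by rewrite muleA -EFinM.
Qed.

(** If all weighted norms are positive take for [theta] these norms; in general
    they are approached from above. *)
Lemma grid_weak_type (lam : R) : (0 < lam)%R ->
  lam%:E * (\int[leb n]_(x in [set x | (lam < S x)%R]) (U x)%:E) `^ m%:R <=
  (6 * 2 ^+ m * Ctau ^+ m)%:E * \prod_(i < m) \int[leb n]_x ((f i x)%:E * w i x).
Proof.
move=> lam0.
have W0 i : (0 <= W i)%R by rewrite fine_ge0// integral_ge0.
under eq_bigr do rewrite WE.
rewrite prodEFin -EFinM.
set E := [set x | (lam < S x)%R].
have c0 : (0 < 6 * 2 ^+ m * Ctau ^+ m)%R by rewrite !mulr_gt0// exprn_gt0.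
have root (theta : 'I_m -> R) : (forall i, W i <= theta i /\ 0 < theta i)%R ->
    exists rho, [/\ (0 <= rho)%R,
      (rho ^+ m = 6 * 2 ^+ m * (\prod_(i < m) theta i) / lam)%R &
      \int[leb n]_(x in E) (U x)%:E <= (Ctau * rho)%:E].
  move=> Wth; have P0 : (0 <= 6 * 2 ^+ m * (\prod_(i < m) theta i) / lam)%R.
    rewrite divr_ge0 ?(ltW lam0)// mulr_ge0 ?mulr_ge0 ?exprn_ge0// prodr_ge0// => i _.
    by case: (Wth i) => _ /ltW.
  exists ((6 * 2 ^+ m * (\prod_(i < m) theta i) / lam) `^ m%:R^-1)%R.
  have re := root_exp P0; split=> //; first exact: powR_ge0.
  by apply: (grid_weak_type_scaled Wth lam0 _ re); exact: powR_ge0.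
have X0 : 0 <= \int[leb n]_(x in E) (U x)%:E.
  by apply: integral_ge0 => x _; rewrite lee_fin.
have [X Xr Xge0] : exists2 X : R, \int[leb n]_(x in E) (U x)%:E = X%:E & (0 <= X)%R.
  have [|rho [_ _]] := root (fun i => W i + 1)%R.
    by move=> i; rewrite lerDl ler01 ltr_wpDl.
  by move: X0; case: (\int[leb n]_(x in E) _) => // r r0 _; exists r.
rewrite Xr poweR_EFin powR_mulrn// -EFinM lee_fin.
apply: le_prod_of_perturbed => // theta Wth.
have [rho [rho0 rhoE]] := root theta Wth.
rewrite Xr lee_fin => XC.
apply: (@le_trans _ _ (lam * (Ctau * rho) ^+ m)%R).
  by rewrite ler_wpM2l ?(ltW lam0)// lerXn2r// nnegrE mulr_ge0// ltW.
rewrite exprMn rhoE le_eqVlt; apply/orP; left; apply/eqP; field.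
by rewrite gt_eqF.
Qed.

End grid_weak_type.

(** * Lower limits, dyadic scales and Euclidean norms *)

Section lower_limits.
Context {R : realType}.
Implicit Types (h : nat -> \bar R) (C : \bar R).

Lemma limn_einfE h : limn_einf h = ereal_sup (range (einfs h)).
Proof. by rewrite limn_einf_lim; apply/cvg_lim => //; exact: cvg_einfs_sup. Qed.

Lemma limn_einf_ge h C N0 : (forall N, (N0 <= N)%N -> C <= h N) -> C <= limn_einf h.
Proof.
move=> hC; rewrite limn_einfE; apply: (@le_trans _ _ (einfs h N0)).
  by apply: le_ereal_inf_tmp => _ [k /= Nk <-]; exact: hC.
by apply: ereal_sup_ubound; exists N0.
Qed.

Lemma limn_einf_le h C : (forall N, h N <= C) -> limn_einf h <= C.
Proof.
move=> hC; rewrite limn_einfE; apply: ge_ereal_sup => _ [k _ <-].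
apply: le_trans (hC k); apply: ereal_inf_lbound; exists k => //=.
Qed.

Lemma limn_einf_gt h C : C < limn_einf h ->
  exists N0, forall N, (N0 <= N)%N -> C < h N.
Proof.
rewrite limn_einfE => /ereal_sup_gt[_ [N0 _ <-] CN0]; exists N0 => N N0N.
by apply: (lt_le_trans CN0); apply: ereal_inf_lbound; exists N.
Qed.

End lower_limits.

Section dyadic_scale.
Context {R : realType}.

Lemma ln_exprz2 (kappa : int) : ln (2 ^ kappa : R)%R = (kappa%:~R * ln 2)%R.
Proof. by rewrite -powR_intmul// ln_powR. Qed.

Let ln2 : (0 < ln 2 :> R)%R. Proof. by rewrite ln_gt0// ltr1n. Qed.

(** [kappa] is one less than the ceiling of the base 2 logarithm of [r]. *)
Lemma dyadic_scaleP (r : R) : (0 < r)%R ->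
  exists kappa : int, (2 ^ kappa < r <= 2 * 2 ^ kappa)%R.
Proof.
move=> r0; pose q := (ln r / ln 2)%R.
have lnr : (ln r = q * ln 2)%R by rewrite /q divfK// gt_eqF.
exists (- Num.floor (- q) - 1)%R.
have /andP[f1 f2] := floor_itv (- q)%R.
have p0 (k : int) : (0 < 2 ^ k :> R)%R by exact: exprz_gt0.
apply/andP; split.
  rewrite -ltr_ln ?posrE// ln_exprz2 lnr ltr_pM2r//.
  by move: f2; rewrite !(intrD, rmorphN)/=; lra.
rewrite -{1}(expr1z (2 : R)) -exprzDr ?unitfE// -ler_ln ?posrE//.
rewrite ln_exprz2 lnr ler_pM2r//.
by move: f1; rewrite !(intrD, rmorphN)/=; lra.
Qed.

(** The index [- (j + kap0)] of the sum defining [Phi1] corresponds to the annulus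
    of size [2 ^ (j + kap0)]. *)
Lemma Phi1_ge n m tau eps (phi : Rnm R n m -> R) (kap0 : int) k :
  (forall y, 0 <= phi y)%R ->
  \sum_(j < k.+1) \int[lebm n m]_(y in annulus (2 ^ (j%:Z + kap0))%R tau eps) (phi y)%:E
  <= Phi1 tau eps phi (2 ^ (k%:Z + kap0))%R.
Proof.
move=> phi0; pose g (nu : int) :=
  \int[lebm n m]_(y in annulus (2 ^ (- nu))%R tau eps) (phi y)%:E.
apply: esum_ge; pose h (j : nat) : int := (- (j%:Z + kap0))%R.
have hinj : set_inj `I_k.+1 h.
  by move=> i j _ _ /oppr_inj/addIr[].
exists (h @` `I_k.+1); last first.
  rewrite (fsbig_image `I_k.+1 h g hinj) -(fsbig_ord _ k.+1 (fun j => g (h j))).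
  by apply: lee_sum => i _; rewrite /g /h opprK.
split; first exact: finite_image.
move=> _ [j /= jk <-]; rewrite ln_exprz2 lnV ?posrE// invrN mulrN mulfK ?gt_eqF//.
rewrite /h rmorphN/= lerN2 ler_int lerD2r; move: jk; lia.
Qed.

End dyadic_scale.

Section euclidean.
Context {R : realType} (n m : nat).

Lemma enorm_ge0 (x : Rn R n) : (0 <= enorm x)%R.
Proof. exact: sqrtr_ge0. Qed.

Lemma coord_le_enorm (x : Rn R n) i : (`|tnth x i| <= enorm x)%R.
Proof.
rewrite -sqrtr_sqr /enorm ler_sqrt ?sumr_ge0//.
  by rewrite (bigD1 i)//= lerDl sumr_ge0// => j _; exact: sqr_ge0.
by move=> j _; exact: sqr_ge0.
Qed.

Lemma coord_le_snorm (y : Rnm R n m) i j :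
  (`|tnth (tnth y i) j| <= snorm y)%R.
Proof.
apply: (le_trans (coord_le_enorm _ _)).
by rewrite /snorm (bigD1 i)//= lerDl sumr_ge0// => k _; exact: enorm_ge0.
Qed.

Lemma leb_point (x : Rn R n) : (0 < n)%N -> leb n [set x] = 0.
Proof.
move=> n0; rewrite (_ : [set x] = [set y : Rn R n | forall i,
    [set tnth x i] (tnth y i)]).
  apply: (tuple_measure_box0 (A := fun i => [set tnth x i]) (i := Ordinal n0)) => //.
  exact: lebesgue_measure_set1.
apply/seteqP; split=> y /=; first by move=> ->.
by move=> h; apply: eq_from_tnth => i; exact: h.
Qed.

Lemma measurable_point (x : Rn R n) : measurable [set x].
Proof.
rewrite (_ : [set x] = [set y : Rn R n | forall i, [set tnth x i] (tnth y i)]).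
  apply: (@measurable_box _ (measurableTypeR R) n (fun i => [set tnth x i])) => i.
  exact: measurable_set1.
apply/seteqP; split=> y /=; first by move=> ->.
by move=> h; apply: eq_from_tnth => i; exact: h.
Qed.

End euclidean.

(** * Truncation *)

Section truncation.
Context {R : realType} (n : nat).
Implicit Types (g : Rn R n -> R) (N : nat).

Definition in_box N (x : Rn R n) := [forall i, `|tnth x i| <= N%:R]%R.

Definition truncate N g x : R :=
  (if (g x <= N%:R) && in_box N x then g x else 0)%R.

Let box_itv N : [set x | in_box N x] =
  [set x : Rn R n | forall i, [set` `[- N%:R, N%:R] ] (tnth x i)]%R.
Proof.
apply/seteqP; split=> x /=.
  by move=> /forallP h i; rewrite in_itv/= -ler_norml.
by move=> h; apply/forallP => i; rewrite ler_norml; have := h i; rewrite in_itv.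
Qed.

Lemma measurable_in_box N : measurable [set x | in_box N x].
Proof. by rewrite box_itv; exact: (measurable_itv_box (fun _ => `[_, _])). Qed.

Lemma leb_in_box N : leb n [set x | in_box N x] < +oo.
Proof.
pose q : Rn R n * R := ([tuple (- N%:R)%R | i < n], (2 * N%:R + 1)%R).
have q0 : (0 < q.2)%R by rewrite /= ltr_wpDl// mulr_ge0.
apply: (@le_lt_trans _ _ (leb n (cube q))); last by rewrite leb_cube// ltry.
apply: le_measure; rewrite ?inE; [exact: measurable_in_box|exact: measurable_cube|].
move=> x /= /forallP h i; have := h i; rewrite tnth_mktuple ler_norml => /andP[? ?].
by split=> //=; lra.
Qed.

Lemma measurable_truncate N g : measurable_fun setT g ->
  measurable_fun setT (truncate N g).
Proof.
move=> mg; apply: measurable_fun_ifT => //.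
apply: measurable_and; last first.
  apply: (measurable_fun_bool true); rewrite setTI.
  exact: measurable_in_box.
exact: measurable_fun_ler.
Qed.

Lemma truncate_ge0 N g x : (forall y, 0 <= g y)%R -> (0 <= truncate N g x)%R.
Proof. by move=> g0; rewrite /truncate; case: ifP. Qed.

Lemma truncate_le N g x : (forall y, 0 <= g y)%R -> (truncate N g x <= g x)%R.
Proof. by move=> g0; rewrite /truncate; case: ifP. Qed.

Lemma truncate_le_bound N g x : (truncate N g x <= N%:R)%R.
Proof. by rewrite /truncate; case: ifP => // /andP[]. Qed.

Lemma truncate_near g x : exists N0, forall N, (N0 <= N)%N -> truncate N g x = g x.
Proof.
have nearr (r : R) : exists N0 : nat, forall N, (N0 <= N)%N -> (r <= N%:R)%R.
  exists (Num.trunc `|r|).+1 => N rN; apply: (le_trans (ler_norm r)).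
  by apply/ltW/(lt_le_trans (truncnS_gt `|r|)); rewrite ler_nat.
have [N1 hN1] := nearr (g x).
have [N2 hN2] := nearr (\sum_(i < n) `|tnth x i|)%R.
exists (maxn N1 N2) => N; rewrite geq_max => /andP[/hN1 h1 /hN2 h2].
rewrite /truncate h1 /=; case: ifPn => // /forallPn[i]; rewrite -ltNge ltNge.
case/negP; apply: le_trans h2.
by rewrite (bigD1 i)//= lerDl sumr_ge0.
Qed.

Lemma integral_truncate_fin N g : measurable_fun setT g -> (forall y, 0 <= g y)%R ->
  \int[leb n]_x (truncate N g x)%:E < +oo.
Proof.
move=> mg g0; have mB := measurable_in_box N.
apply: (@le_lt_trans _ _ (\int[leb n]_(x in [set x | in_box N x]) (cst N%:R%:E x))).
  rewrite [leRHS]integral_mkcond; apply: le_lower_integral => // x.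
  - by move=> _; rewrite lee_fin truncate_ge0.
  - by move=> _; apply: erestrict_ge0 => y _; rewrite lee_fin.
  move=> _; split=> //; rewrite /patch; case: ifPn => [_|].
    by rewrite lee_fin truncate_le_bound.
  by rewrite notin_setE /= /truncate => /negP/negbTE ->; rewrite andbF.
rewrite integral_cst//; apply: lte_mul_pinfty => //; exact: leb_in_box.
Qed.

End truncation.

(** * Domination of the kernel by dyadic operators *)

Section kernel_domination.
Context {R : realType} (n m : nat).
Variables (tau eps C : R) (phi : Rnm R n m -> R).
Hypothesis phi_ge0 : forall y, (0 <= phi y)%R.
Hypothesis phi_loc : forall r : R,
  \int[lebm n m]_(y in [set y | (snorm y <= r)%R]) `|phi y|%:E < +oo.
Hypothesis C_gt0 : (0 < C)%R.
Hypothesis phiD : forall k : int,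
  ereal_sup [set (phi w)%:E | w in annulus (2 ^ k)%R 1 0] <=
  (C / 2 ^ (k * (n * m)%N%:Z))%R%:E *
    \int[lebm n m]_(y in annulus (2 ^ k)%R tau eps) (phi y)%:E.

Definition annulus_mass (kappa : int) : R :=
  fine (\int[lebm n m]_(y in annulus (2 ^ kappa)%R tau eps) (phi y)%:E).

Lemma annulus_massE kappa : (annulus_mass kappa)%:E =
  \int[lebm n m]_(y in annulus (2 ^ kappa)%R tau eps) (phi y)%:E.
Proof.
rewrite fineK// ge0_fin_numE; last by apply: integral_ge0 => y _; rewrite lee_fin.
apply: le_lt_trans (phi_loc (tau * (1 + eps) * (2 * 2 ^ kappa))%R).
apply: le_lower_integral => y.
- by move=> _; rewrite lee_fin.
- by move=> _; rewrite lee_fin.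
by move=> [_ h]; split=> //; rewrite ger0_norm.
Qed.

Lemma annulus_mass_ge0 kappa : (0 <= annulus_mass kappa)%R.
Proof.
rewrite fine_ge0// integral_ge0// => y _.
by rewrite lee_fin.
Qed.

Lemma phi_le_annulus_mass kappa (w : Rnm R n m) :
  (2 ^ kappa < snorm w <= 2 * 2 ^ kappa)%R ->
  (phi w <= C / 2 ^ (kappa * (n * m)%N%:Z) * annulus_mass kappa)%R.
Proof.
move=> /andP[w1 w2]; rewrite -lee_fin EFinM annulus_massE.
apply: le_trans (phiD kappa); apply: ereal_sup_ubound; exists w => //.
by split; rewrite ?subr0 ?addr0 !mul1r.
Qed.

(** [k - N] runs through the dyadic exponents of absolute value at most [N]; the
    grid of index [k] has mesh [2 ^ (k - N + 4)], eight times the radius of the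
    balls of the annulus of size [2 ^ (k - N)]. *)
Definition dominant N (f : 'I_m -> Rn R n -> R) (x : Rn R n) (y : Rnm R n m) : \bar R :=
  \sum_(t : {ffun 'I_n -> bool}) \sum_(k < (2 * N).+1)
    (C / 2 ^ ((k%:Z - N%:Z) * (n * m)%N%:Z) * annulus_mass (k%:Z - N%:Z))%:E *
    \prod_(i < m) (truncate N (f i) (tnth y i) *
      (grid_at t (4 - N%:Z) k (tnth y i) == grid_at t (4 - N%:Z) k x)%R%:R)%:E.

Let coef_ge0 kappa : (0 <= C / 2 ^ (kappa * (n * m)%N%:Z) * annulus_mass kappa)%R.
Proof. by rewrite mulr_ge0 ?annulus_mass_ge0// divr_ge0 ?(ltW C_gt0)// exprz_ge0. Qed.

(** Off the diagonal the point [(x - y i)] lies in one dyadic annulus; one grid has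
    all the [y i] in the cell of [x] of the matching scale, and once [N] exceeds
    that scale and the truncation levels, the corresponding term of [dominant]
    is present. *)
Lemma kernel_le_dominant (f f0 : 'I_m -> Rn R n -> R) (x : Rn R n) (y : Rnm R n m) :
  (forall i z, 0 <= f i z)%R ->
  (forall i, `|f0 i (tnth y i)| = f i (tnth y i))%R ->
  (exists i, tnth y i <> x) ->
  exists N0, forall N, (N0 <= N)%N -> `|multi_kernel phi f0 x y| <= dominant N f x y.
Proof.
move=> f_ge0 f0E [i0 yx].
pose z : Rnm R n m := [tuple vsub x (tnth y i) | i < m].
have zE i j : tnth (tnth z i) j = (tnth x j - tnth (tnth y i) j)%R.
  by rewrite !tnth_mktuple.
have z_gt0 : (0 < snorm z)%R.
  rewrite lt_neqAle; apply/andP; split; last first.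
    by apply: sumr_ge0 => i _; exact: enorm_ge0.
  apply/eqP => z0; apply: yx; apply: eq_from_tnth => j.
  have := coord_le_snorm z i0 j; rewrite -z0 normr_le0 zE subr_eq0 => /eqP.
  by [].
have [kappa /andP[zl zr]] := dyadic_scaleP z_gt0.
have [t ht] : exists t, forall i, grid t (kappa + 4) (tnth y i) = grid t (kappa + 4) x.
  have [t ht] := grid_cover (kappa + 4) x; exists t => i; apply: ht => j.
  rewrite -zE; apply: (le_trans (coord_le_snorm z i j)); apply: (le_trans zr).
  rewrite exprzDr ?unitfE// [(2 ^ 4 : R)%R](_ : _ = 16)%R; last by rewrite -exprnP; lra.
  by have : (0 < 2 ^ kappa :> R)%R by [exact: exprz_gt0]; lra.
have /choice[N1 hN1] : forall i, exists N0, forall N, (N0 <= N)%N ->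
    truncate N (f i) (tnth y i) = f i (tnth y i).
  by move=> i; exact: truncate_near.
exists (maxn `|kappa|%N (\max_(i < m) N1 i)) => N; rewrite geq_max => /andP[kN /bigmax_leqP N1N].
have kk : (`|(kappa + N%:Z)%R|%N < (2 * N).+1)%N by lia.
have kE : (`|(kappa + N%:Z)%R|%N%:Z - N%:Z = kappa)%R by lia.
rewrite /dominant (bigD1 t)//= (bigD1 (Ordinal kk))//=.
rewrite -[leLHS]adde0 -addeA; apply: leeD; last first.
  apply: adde_ge0.
    by apply: sume_ge0 => k _; rewrite mule_ge0 ?lee_fin// prode_ge0// => i _;
      rewrite lee_fin mulr_ge0// truncate_ge0.
  apply: sume_ge0 => t' _; apply: sume_ge0 => k _.
  rewrite mule_ge0 ?lee_fin// prode_ge0// => i _.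
  by rewrite lee_fin mulr_ge0// truncate_ge0.
rewrite kE prodEFin /multi_kernel -EFinM /= lee_fin normrM normr_prod.
rewrite ger0_norm ?phi_ge0//; apply: ler_pM => //.
- by apply: prodr_ge0.
- by apply: phi_le_annulus_mass; rewrite zl.
rewrite le_eqVlt; apply/orP; left; apply/eqP; apply: eq_bigr => i _.
rewrite f0E hN1 ?N1N// /grid_at /scale.
rewrite (_ : _ + (4 - N%:Z) = kappa + 4)%R; last by lia.
by rewrite ht eqxx mulr1.
Qed.

Let cut N t k (f : 'I_m -> Rn R n -> R) (x : Rn R n) i (z : Rn R n) : \bar R :=
  (truncate N (f i) z *
    (grid_at t (4 - N%:Z) k z == grid_at t (4 - N%:Z) k x)%R%:R)%:E.

Let mgrid t kap0 k z : measurable (grid_at t kap0 k @^-1` [set z] : set (Rn R n)).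
Proof. exact: measurable_grid_fiber. Qed.

Let mcut N t k f x i : measurable_fun setT (f i) ->
  measurable_fun setT (cut N t k f x i).
Proof.
move=> mf; apply/measurable_EFinP; apply: measurable_funM.
  exact: measurable_truncate.
apply: (cellwise_measurable (c := grid_at t (4 - N%:Z)) (mgrid t (4 - N%:Z)) (k := k)).
by move=> z z' ->.
Qed.

Let cut_ge0 N t k f x i z : (forall i z, 0 <= f i z)%R -> 0 <= cut N t k f x i z.
Proof. by move=> f0; rewrite lee_fin mulr_ge0// truncate_ge0. Qed.

Let mprod_cut N t k f x : (forall i, measurable_fun setT (f i)) ->
  measurable_fun setT (fun y : Rnm R n m => \prod_(i < m) cut N t k f x i (tnth y i)).
Proof.
by move=> mf; apply: (measurable_tnth_prod (g := cut N t k f x)) => i; exact: mcut.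
Qed.

Lemma measurable_dominant N (f : 'I_m -> Rn R n -> R) (x : Rn R n) :
  (forall i, measurable_fun setT (f i)) ->
  measurable_fun setT (dominant N f x).
Proof.
move=> mf; apply: emeasurable_sum => t; apply: emeasurable_sum => k.
by apply: measurable_funeM; exact: mprod_cut.
Qed.

Lemma dominant_ge0 N (f : 'I_m -> Rn R n -> R) (x : Rn R n) y :
  (forall i z, 0 <= f i z)%R -> 0 <= dominant N f x y.
Proof.
move=> f0; apply: sume_ge0 => t _; apply: sume_ge0 => k _.
rewrite mule_ge0 ?lee_fin// prode_ge0// => i _.
by rewrite lee_fin mulr_ge0// truncate_ge0.
Qed.

Definition grid_sum N (f : 'I_m -> Rn R n -> R) t (x : Rn R n) : R :=
  (\sum_(k < (2 * N).+1) annulus_mass (k%:Z - N%:Z) *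
    prod_mean (leb n) (grid_at t (4 - N%:Z)) (fun k => side (4 - N%:Z) k ^+ n)
      (fun i => truncate N (f i)) k x)%R.

(** Tonelli's theorem; the measure [16 ^ n * 2 ^ (kappa * n)] of the cells
    compensates the normalisation [2 ^ (- kappa * n * m)] of the class D. *)
Lemma integral_dominant N (f : 'I_m -> Rn R n -> R) (x : Rn R n) :
  (forall i, measurable_fun setT (f i)) ->
  (forall i z, 0 <= f i z)%R ->
  \int[lebm n m]_y dominant N f x y =
  (C * 16 ^+ (n * m) * \sum_(t : {ffun 'I_n -> bool}) grid_sum N f t x)%:E.
Proof.
move=> mf f0.
have pc0 t k (y : Rnm R n m) : 0 <= \prod_(i < m) cut N t k f x i (tnth y i).
  by apply: prode_ge0 => i _; exact: cut_ge0.
rewrite ge0_integral_sum//; last 2 first.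
- move=> t; apply: emeasurable_sum => k.
  by apply: measurable_funeM; exact: mprod_cut.
- by move=> t y _; apply: sume_ge0 => k _; rewrite mule_ge0 ?lee_fin// pc0.
rewrite mulr_sumr -sumEFin; apply: eq_bigr => t _.
rewrite ge0_integral_sum//; last 2 first.
- by move=> k; apply: measurable_funeM; exact: mprod_cut.
- by move=> k y _; rewrite mule_ge0 ?lee_fin// pc0.
rewrite /grid_sum mulr_sumr -sumEFin; apply: eq_bigr => k _.
rewrite ge0_integralZl ?lee_fin//; last 2 first.
- exact: mprod_cut.
- by move=> y _; exact: pc0.
set kappa := (k%:Z - N%:Z)%R.
pose sd : R := (side (4 - N%:Z) k ^+ n)%R.
have sideE : side (4 - N%:Z) k = (2 ^ kappa * 16 :> R)%R.
  rewrite /side /scale (_ : _ + _ = kappa + 4)%R; last by rewrite /kappa; lia.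
  by rewrite exprzDr ?unitfE//; congr (_ * _)%R; rewrite -exprnP; lra.
have p0 : (0 < 2 ^ kappa :> R)%R by exact: exprz_gt0.
have sd_gt0 l : (0 < side (4 - N%:Z) l ^+ n :> R)%R by rewrite exprn_gt0// exprz_gt0.
rewrite /lebm (integral_tuple_measure_prod (leb n) (g := cut N t k f x)); last 2 first.
- by move=> i; exact: mcut.
- by move=> i z; exact: cut_ge0.
rewrite (eq_bigr (fun i => (mean (leb n) (grid_at t (4 - N%:Z))
    (fun k => side (4 - N%:Z) k ^+ n) (fun i => truncate N (f i)) i k x * sd)%:E));
  last first.
  move=> i _; have tr0 (j : 'I_m) y : (0 <= truncate N (f j) y)%R by exact: truncate_ge0.
  have trfin (j : 'I_m) l y :
      \int[leb n]_(z in cell (grid_at t (4 - N%:Z)) l y) (truncate N (f j) z)%:E < +oo.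
    apply: le_lt_trans (integral_truncate_fin N (mf j) (f0 j)).
    by apply: le_lower_integral => // z _; rewrite lee_fin.
  rewrite -(meanE sd_gt0 tr0 trfin) integral_mkcond; apply: eq_integral => z _.
  rewrite /cut /patch; case: ifPn.
    by rewrite inE /cell /= => ->; rewrite eqxx mulr1.
  rewrite notin_setE /cell /= => /eqP/negbTE ->.
  by rewrite mulr0.
rewrite prodEFin -EFinM; congr EFin; rewrite /prod_mean big_split/=.
rewrite prodr_const card_ord /sd sideE -exprM exprMn.
have -> : (2 ^ (kappa * (n * m)%N%:Z) = (2 ^ kappa) ^+ (n * m) :> R)%R.
  by rewrite exprnP exprz_exp.
have : (0 < (2 ^ kappa) ^+ (n * m) :> R)%R by rewrite exprn_gt0.
set P := (\prod_(i < m) _)%R.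
move: ((2 ^ kappa) ^+ (n * m))%R (16 ^+ (n * m))%R (annulus_mass kappa) => p q am pp.
by field; rewrite gt_eqF.
Qed.

End kernel_domination.

(** * Pointwise control of the operator *)

Lemma measurable_fun_limn_einf d (T : measurableType d) (R : realType)
    (h : nat -> T -> \bar R) : (forall k, measurable_fun setT (h k)) ->
  measurable_fun setT (fun x => limn_einf (h ^~ x)).
Proof.
move=> mh; rewrite /limn_einf; apply: measurableT_comp => //.
apply: measurable_fun_limn_esup => k; exact: measurableT_comp.
Qed.

Lemma tuple_measure_coordinate0 d (T : measurableType d) (R : realType)
    (mu : {sigma_finite_measure set T -> \bar R}) n (N : set T) (i : 'I_n) :
  measurable N -> mu N = 0 ->
  measurable [set y : n.-tuple T | N (tnth y i)] /\
  tuple_measure mu n [set y : n.-tuple T | N (tnth y i)] = 0.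
Proof.
move=> mN N0; pose A j := if j == i then N else setT.
have mA j : measurable (A j) by rewrite /A; case: ifP.
rewrite (_ : mkset _ = [set y : n.-tuple T | forall j, A j (tnth y j)]).
  split; first exact: measurable_box.
  by apply: (tuple_measure_box0 (i := i)) => //; rewrite /A eqxx.
apply/seteqP; split=> y /=; last by move=> /(_ i); rewrite /A eqxx.
by move=> Ny j; rewrite /A; case: eqP => // ->.
Qed.

Lemma measure_bigsetU0 d (T : measurableType d) (R : realType)
    (mu : {measure set T -> \bar R}) n (A : 'I_n -> set T) :
  (forall i, measurable (A i) /\ mu (A i) = 0) ->
  let B := \big[setU/set0]_(i < n) A i in
  [/\ measurable B, mu B = 0 & forall i, A i `<=` B].
Proof.
move=> A0 B; have [mB B0] : measurable B /\ mu B = 0.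
  rewrite /B; elim/big_ind : _ => [|X Y [mX X0] [mY Y0]|i _//].
    by rewrite measure0.
  split; first exact: measurableU.
  apply/eqP; rewrite eq_le measure_ge0 andbT.
  apply: (@le_trans _ _ (mu X + mu Y)); first exact: measureU2.
  by rewrite X0 Y0 adde0.
by split=> // i x Aix; rewrite /B (bigD1 i)//=; left.
Qed.

Section pointwise_bound.
Context {R : realType} (n m : nat).
Hypothesis n_gt0 : (0 < n)%N.
Hypothesis m_gt0 : (0 < m)%N.
Variables (tau eps C : R) (phi : Rnm R n m -> R).
Hypothesis phi_ge0 : forall y, (0 <= phi y)%R.
Hypothesis phi_loc : forall r : R,
  \int[lebm n m]_(y in [set y | (snorm y <= r)%R]) `|phi y|%:E < +oo.
Hypothesis C_gt0 : (0 < C)%R.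
Hypothesis phiD : forall k : int,
  ereal_sup [set (phi w)%:E | w in annulus (2 ^ k)%R 1 0] <=
  (C / 2 ^ (k * (n * m)%N%:Z))%R%:E *
    \int[lebm n m]_(y in annulus (2 ^ k)%R tau eps) (phi y)%:E.

Lemma measurable_grid_sum N (f : 'I_m -> Rn R n -> R) t :
  measurable_fun setT (grid_sum tau eps phi N f t).
Proof.
apply: measurable_sum => k; apply: measurable_funM => //.
have mgrid l z : measurable (grid_at t (4 - N%:Z) l @^-1` [set z] : set (Rn R n)).
  exact: measurable_grid_fiber.
apply: (cellwise_measurable mgrid (k := k)) => x y xy.
exact: prod_mean_cell.
Qed.

(** The diagonal and the exceptional sets of the [f0 i] are null for the product
    measure; elsewhere [kernel_le_dominant] holds for large [N], and Fatou's lemma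
    passes to the integrals. *)
Lemma multi_op_eventually_lt (f0 f : 'I_m -> Rn R n -> R) (x : Rn R n) (lam : R) :
  (forall i, measurable_fun setT (f i)) -> (forall i z, 0 <= f i z)%R ->
  (forall i, exists N, [/\ measurable N, leb n N = 0 &
    forall z, ~ N z -> `|f0 i z|%R = f i z]) ->
  lam%:E < `|multi_op phi f0 x| ->
  exists N0, forall N, (N0 <= N)%N ->
    (lam < C * 16 ^+ (n * m) *
      \sum_(t : {ffun 'I_n -> bool}) grid_sum tau eps phi N f t x)%R.
Proof.
move=> mf f_ge0 /choice[Nf hNf] lamT.
pose diag := [set y : Rnm R n m | forall i, [set x] (tnth y i)].
have [mB B0 badB] := measure_bigsetU0 (mu := lebm n m)
    (A := fun i => [set y : Rnm R n m | Nf i (tnth y i)])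
    (fun i => let: And3 mN N0 _ := hNf i in tuple_measure_coordinate0 i mN N0).
move: mB B0 badB; set B := (\big[setU/set0]_(i < m) _) => mB B0 badB.
have mdiag : measurable diag.
  by apply: (measurable_box (A := fun=> [set x])) => i; exact: measurable_point.
have diag0 : lebm n m diag = 0.
  exact: (tuple_measure_box0 (A := fun=> [set x]) (i := Ordinal m_gt0)
    (fun=> measurable_point x) (leb_point x n_gt0)).
have mbad : measurable (diag `|` B) by exact: measurableU.
have bad0 : lebm n m (diag `|` B) = 0.
  apply/eqP; rewrite eq_le measure_ge0 andbT.
  apply: (@le_trans _ _ (lebm n m diag + lebm n m B)); first exact: measureU2.
  by rewrite diag0 B0 adde0.
pose H (y : Rnm R n m) := limn_einf (fun N => dominant tau eps C phi N f x y).
have dom0 N y : 0 <= dominant tau eps C phi N f x y by exact: dominant_ge0.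
have mdom N : measurable_fun setT (dominant tau eps C phi N f x).
  exact: measurable_dominant.
have mH : measurable_fun setT H by exact: measurable_fun_limn_einf.
have H0 y : 0 <= H y by apply: (limn_einf_ge (N0 := 0%N)) => N _.
have kH y : ~ (diag `|` B) y -> `|multi_kernel phi f0 x y| <= H y.
  move=> /not_orP[ndiag nB].
  have f0E i : (`|f0 i (tnth y i)| = f i (tnth y i))%R.
    by have [_ _ h] := hNf i; apply: h => Ny; apply: nB; apply: badB Ny.
  have [i yx] : exists i, tnth y i <> x.
    by apply: contrapT => /forallNP h; apply: ndiag => i; apply: contrapT; exact: h.
  have [N0 hN0] := kernel_le_dominant phi_ge0 phi_loc C_gt0 phiD f_ge0 f0E
    (ex_intro _ i yx).
  exact: limn_einf_ge hN0.
have TH : `|multi_op phi f0 x| <= \int[lebm n m]_y H y.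
  exact: (abse_integral_le mbad bad0 mH H0 kH).
have fat := fatou (lebm n m) measurableT mdom (fun N y _ => dom0 N y).
have /limn_einf_gt[N0 hN0] := lt_le_trans lamT (le_trans TH fat).
exists N0 => N /hN0; rewrite integral_dominant// ?lte_fin//.
Qed.

End pointwise_bound.

(** * The weak-type bound in terms of the maximal operators *)

Lemma le_prode (R : realDomainType) n (h g : 'I_n -> \bar R) :
  (forall i, 0 <= h i) -> (forall i, h i <= g i) ->
  \prod_(i < n) h i <= \prod_(i < n) g i.
Proof.
move=> h0 hg.
have [] // : 0 <= \prod_(i < n) h i /\ \prod_(i < n) h i <= \prod_(i < n) g i.
elim/big_rec2 : _ => [|i x y _ [y0 yx]]; first by split.
split; first by rewrite mule_ge0.
by rewrite lee_pmul.
Qed.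

Section truncated_weak_type.
Context {R : realType} (n m : nat).
Hypothesis m_gt0 : (0 < m)%N.
Variables (tau eps : R) (phi : Rnm R n m -> R).
Hypothesis phi_ge0 : forall y, (0 <= phi y)%R.
Hypothesis phi_loc : forall r : R,
  \int[lebm n m]_(y in [set y | (snorm y <= r)%R]) `|phi y|%:E < +oo.
Variable delta : R.
Hypothesis delta_gt0 : (0 < delta)%R.
Variables (f0 f u0 u : 'I_m -> Rn R n -> R).
Hypothesis mf : forall i, measurable_fun setT (f i).
Hypothesis f_bounds : forall i x, (0 <= f i x <= `|f0 i x|)%R.
Hypothesis u_meas : forall i, measurable_fun setT (u i).
Hypothesis u_bounds : forall i x, (0 <= u i x <= u0 i x)%R.
Variable Ctau : R.
Hypothesis Ctau_gt0 : (0 < Ctau)%R.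
Hypothesis Ctau_le : forall J,
  (2 * thinness delta 0 + 8 * \sum_(j < J) thinness delta (2 ^ j.+1)%N <= Ctau)%R.

(** The dyadic maximal functions of the truncated data are pointwise below
    [M_LlogL] and [M_Phi].  The cells used for the annulus of size
    [2 ^ k] have side [2 ^ (k + 4)], and [Phi1] is monotone. *)
Lemma grid_sum_weak_type t N (lam : R) : (0 < lam)%R ->
  lam%:E * (\int[leb n]_(x in [set x | (lam < grid_sum tau eps phi N f t x)%R])
    (\prod_(i < m) truncate N (u i) x `^ m%:R^-1)%R%:E) `^ m%:R <=
  (6 * 2 ^+ m * Ctau ^+ m)%:E * \prod_(i < m)
    \int[leb n]_x (`|f0 i x|%:E *
      M_Phi m (Phi1 tau eps phi) (M_LlogL delta (u0 i)) x).
Proof.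
move=> lam0.
have f_ge0 i x : (0 <= f i x)%R by case/andP: (f_bounds i x).
have u_ge0 i x : (0 <= u i x)%R by case/andP: (u_bounds i x).
pose am (k : nat) : R := annulus_mass tau eps phi (k%:Z - N%:Z).
pose a (k : nat) : R := (if (k <= 2 * N)%N then am k else 0)%R.
have a_ge0 k : (0 <= a k)%R by rewrite /a; case: ifP => // _; exact: annulus_mass_ge0.
have a_eq0 k : (2 * N < k)%N -> a k = 0%R by rewrite /a ltnNge => /negbTE ->.
have mt i : measurable_fun setT (truncate N (u i)) by exact: measurable_truncate.
have ut0 i x : (0 <= truncate N (u i) x)%R by exact: truncate_ge0.
have mft i : measurable_fun setT (truncate N (f i)) by exact: measurable_truncate.
have ft0 i x : (0 <= truncate N (f i) x)%R by exact: truncate_ge0.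
have ftfin i : \int[leb n]_x (truncate N (f i) x)%:E < +oo.
  exact: integral_truncate_fin.
have N1 : (0 < N%:R + 1 :> R)%R by rewrite ltr_wpDl.
have utN i x : (truncate N (u i) x <= N%:R + 1)%R.
  by rewrite (le_trans (truncate_le_bound _ _ _))// lerDl.
have := grid_weak_type m_gt0 t (4 - N%:Z)%R delta_gt0 a_ge0 a_eq0 mft ft0 ftfin mt ut0
  N1 utN Ctau_gt0 Ctau_le lam0.
have -> : [set x | (lam < \sum_(k < (2 * N).+1) a k *
      prod_mean (leb n) (grid_at t (4 - N%:Z)) (fun k => side (4 - N%:Z) k ^+ n)
        (fun i => truncate N (f i)) k x)%R] =
    [set x | (lam < grid_sum tau eps phi N f t x)%R].
  have e x : (\sum_(k < (2 * N).+1) a k *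
      prod_mean (leb n) (grid_at t (4 - N%:Z)) (fun k => side (4 - N%:Z) k ^+ n)
        (fun i => truncate N (f i)) k x = grid_sum tau eps phi N f t x)%R.
    by apply: eq_bigr => k _; rewrite /a -ltnS ltn_ord.
  by apply/seteqP; split=> x /=; rewrite e.
move=> /le_trans; apply.
apply: lee_wpmul2l; first by rewrite lee_fin !mulr_ge0// exprn_ge0// ltW.
have v0 i x : 0 <= grid_LlogL t (4 - N%:Z) delta (truncate N (u i)) x.
  exact: grid_LlogL_ge0.
apply: le_prode => i.
  apply: integral_ge0 => x _; rewrite mule_ge0 ?lee_fin//.
  exact: grid_fractional_ge0.
have w0 x : 0 <= grid_fractional m t (4 - N%:Z) a
    (grid_LlogL t (4 - N%:Z) delta (truncate N (u i))) x.
  exact: grid_fractional_ge0.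
have wM x : grid_fractional m t (4 - N%:Z) a
    (grid_LlogL t (4 - N%:Z) delta (truncate N (u i))) x <=
    M_Phi m (Phi1 tau eps phi) (M_LlogL delta (u0 i)) x.
  apply: grid_fractional_le => // [k|y].
    have -> : side (4 - N%:Z) k = (2 ^ ((k + 4)%N%:Z + - N%:Z) : R)%R.
      by rewrite /side /scale; congr (_ ^ _)%R; lia.
    apply: le_trans (Phi1_ge tau eps (- N%:Z) (k + 4) phi_ge0).
    rewrite -addSn big_split_ord /= -[leLHS]adde0; apply: leeD; last first.
      by apply: sume_ge0 => j _; apply: integral_ge0 => y _; rewrite lee_fin.
    rewrite -sumEFin; apply: lee_sum => j _; rewrite /a; case: ifP => _.
      by rewrite /am annulus_massE.
    by apply: integral_ge0 => y _; rewrite lee_fin.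
  rewrite v0 /=; apply: grid_LlogL_le => // z.
  rewrite ut0 /=; case/andP: (u_bounds i z) => _; apply: le_trans.
  exact: truncate_le.
apply: le_lower_integral => // x.
- by move=> _; rewrite mule_ge0 ?lee_fin.
- by move=> _; rewrite mule_ge0 ?lee_fin// (le_trans (w0 x)).
move=> _; split=> //; apply: lee_pmul => //.
- by rewrite lee_fin.
rewrite lee_fin; case/andP: (f_bounds i x) => _; apply: le_trans.
exact: truncate_le.
Qed.

End truncated_weak_type.

(** * The weak-type inequality *)

Theorem corollary3p15 (R : realType) (n m : nat) (n_gt0 : (0 < n)%N)
    (m_gt0 : (0 < m)%N) (tau eps : R) (phi : Rnm R n m -> R)
    (phiD : classD tau eps phi) (delta : R) (delta_gt0 : (0 < delta)%R)
    (u : 'I_m -> Rn R n -> R) (u_weight : forall i, weight (u i)) :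
  exists2 C : R, (0 < C)%R &
    forall f : 'I_m -> Rn R n -> R,
      (forall i, completed_measurable_fun (leb n) (f i)) ->
      multi_op_defined phi f ->
      weak_norm m%:R^-1 (fun x => \prod_(i < m) u i x `^ m%:R^-1)%R
        (multi_op phi f) <=
      C%:E * \prod_(i < m)
        \int[leb n]_x (`|f i x|%:E *
          M_Phi m (Phi1 tau eps phi) (M_LlogL delta (u i)) x).
Proof.
have [phi_ge0 [_ phi_loc] _ _ [C C_gt0 phi_sup]] := phiD.
have [Ctau [Ctau_gt0 Ctau_le]] := sum_thinness_le delta_gt0.
have m0 : (m%:R != 0 :> R)%R by rewrite pnatr_eq0 -lt0n.
pose G : nat := #|{: {ffun 'I_n -> bool}}|.
have G_gt0 : (0 < G%:R :> R)%R.
  by rewrite ltr0n; apply/card_gt0P; exists [ffun=> false].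
pose D : R := (C * 16 ^+ (n * m))%R.
have D_gt0 : (0 < D)%R by rewrite mulr_gt0// exprn_gt0.
pose Cg : R := (6 * 2 ^+ m * Ctau ^+ m)%R.
have Cg_gt0 : (0 < Cg)%R by rewrite !mulr_gt0// exprn_gt0.
exists (G%:R ^+ m * (D * G%:R) * Cg)%R.
  by rewrite !mulr_gt0// exprn_gt0.
move=> f cf _; set B := \prod_(i < m) _.
(* [f i] and [u i] are measurable for the completion only; Borel minorants equal
   to them almost everywhere bound the left-hand side from above through null
   sets and the right-hand side from below pointwise *)
have borel (h : Rn R n -> R) : completed_measurable_fun (leb n) h ->
    exists g : Rn R n -> R, [/\ measurable_fun setT g,
      forall x, (0 <= g x <= `|h x|)%R &
      exists N, [/\ measurable N, leb n N = 0 & forall x, ~ N x -> `|h x|%R = g x]].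
  move=> /completed_measurable_fun_ae[N [mN N0 mh]].
  exists (fun x => `|if x \in N then 0 else h x|)%R; split.
  - exact: (measurableT_comp (@normr_measurable R setT) mh).
  - by move=> x; rewrite normr_ge0 /=; case: ifPn; rewrite ?normr0 ?lexx.
  - by exists N; split=> // x Nx; rewrite memNset.
have /choice[g hg] i := borel _ (cf i).
have /choice[w hw] i : exists g : Rn R n -> R, [/\ measurable_fun setT g,
      forall x, (0 <= g x <= u i x)%R &
      exists N, [/\ measurable N, leb n N = 0 & forall x, ~ N x -> u i x = g x]].
  have [u0 [cu _]] := u_weight i; have [h [mh h_le [N [mN N0 hN]]]] := borel _ cu.
  exists h; split=> // [x|]; first by have := h_le x; rewrite ger0_norm.
  by exists N; split=> // x /hN; rewrite ger0_norm.
have mg i : measurable_fun setT (g i) by case: (hg i).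
have g_bounds i x : (0 <= g i x <= `|f i x|)%R by case: (hg i) => _ + _; exact.
have g_ge0 i x : (0 <= g i x)%R by case/andP: (g_bounds i x).
have mw i : measurable_fun setT (w i) by case: (hw i).
have w_bounds i x : (0 <= w i x <= u i x)%R by case: (hw i) => _ + _; exact.
have w_ge0 i x : (0 <= w i x)%R by case/andP: (w_bounds i x).
have g_ae i : exists N, [/\ measurable N, leb n N = 0 &
    forall z, ~ N z -> `|f i z|%R = g i z] by case: (hg i).
have /choice[Nw hNw] i : exists N, [/\ measurable N, leb n N = 0 &
    forall z, ~ N z -> u i z = w i z] by case: (hw i).
have [mZ Z0 NwZ] := measure_bigsetU0 (mu := leb n) (A := Nw)
    (fun i => let: And3 mN N0 _ := hNw i in conj mN N0).
move: mZ Z0 NwZ; set Z := (\big[setU/set0]_(i < m) _) => mZ Z0 NwZ.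
have u_ge0 i x : (0 <= u i x)%R by case: (u_weight i).
have U_ge0 x : (0 <= \prod_(i < m) u i x `^ m%:R^-1)%R.
  by apply: prodr_ge0 => i _; exact: powR_ge0.
have B_ge0 : 0 <= B.
  apply: prode_ge0 => i _; apply: integral_ge0 => x _.
  rewrite mule_ge0 ?lee_fin//; apply: le_ereal_sup_tmp.
  have x0 : cubes_at x (grid_cube [ffun=> false] 0 x) by exact: grid_cube_at.
  exists (Phi1 tau eps phi (grid_cube [ffun=> false] 0 x).2 `^ m%:R^-1 *
      avg (grid_cube [ffun=> false] 0 x) (fun z => `|M_LlogL delta (u i) z|)).
    by exists (grid_cube [ffun=> false] 0 x).
  rewrite mule_ge0 ?poweR_ge0// mule_ge0 ?lee_fin ?invr_ge0 ?fine_ge0//.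
  by apply: integral_ge0 => y _; exact: abse_ge0.
apply: ge_ereal_sup => _ [lam /= lam_gt0 <-]; rewrite invrK.
pose S N x : R := (\sum_(t : {ffun 'I_n -> bool}) grid_sum tau eps phi N g t x)%R.
pose V N x : R := (\prod_(i < m) truncate N (w i) x `^ m%:R^-1)%R.
have V_ge0 N x : (0 <= V N x)%R by apply: prodr_ge0 => i _; exact: powR_ge0.
have mV N : measurable_fun setT (V N).
  apply: measurable_prod => i _; apply: (measurableT_comp (measurable_powR _)).
  exact: measurable_truncate.
(* if the sum of [G] grid sums exceeds [lam / D], one of them exceeds [lam'] *)
pose lam' : R := (lam / (D * G%:R))%R.
have lam'_gt0 : (0 < lam')%R by rewrite divr_gt0// mulr_gt0.
pose E N t := [set x | (lam' < grid_sum tau eps phi N g t x)%R].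
have mE N t : measurable (E N t).
  have mlt : measurable_fun setT (fun x => lam' < grid_sum tau eps phi N g t x)%R.
    by apply: measurable_fun_ltr => //; exact: measurable_grid_sum.
  by have := mlt measurableT [set true] Logic.I; rewrite setTI.
pose F N x : \bar R := \sum_(t : {ffun 'I_n -> bool}) ((fun x => (V N x)%:E) \_ (E N t)) x.
have Ft_ge0 N t x : 0 <= ((fun x => (V N x)%:E) \_ (E N t)) x.
  by apply: erestrict_ge0 => y _; rewrite lee_fin.
have F_ge0 N x : 0 <= F N x by exact: sume_ge0.
have mFt N t : measurable_fun setT ((fun x => (V N x)%:E) \_ (E N t)).
  by apply/(measurable_restrictT _ (mE N t))/measurable_funTS/measurable_EFinP.
have mF N : measurable_fun setT (F N) by exact: emeasurable_sum.
pose Y := ((lam'^-1)%:E * (Cg%:E * B)) `^ m%:R^-1.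
have Y_ge0 : 0 <= Y by exact: poweR_ge0.
have intE N t : \int[leb n]_(x in E N t) (V N x)%:E <= Y.
  have X0 : 0 <= \int[leb n]_(x in E N t) (V N x)%:E.
    by apply: integral_ge0 => x _; rewrite lee_fin.
  have := grid_sum_weak_type m_gt0 tau eps phi_ge0 phi_loc delta_gt0 mg g_bounds mw w_bounds
    Ctau_gt0 Ctau_le t N lam'_gt0.
  rewrite -/(E N t) -lee_pdivlMl//.
  move=> h; rewrite -[leLHS](poweRe1 X0) -(mulfV m0) poweRrM.
  apply: gt0_ler_poweR; [by rewrite invr_ge0| | |exact: h].
    by rewrite in_itv/= leey poweR_ge0.
  by rewrite in_itv/= leey andbT; exact: le_trans (poweR_ge0 _ _) h.
have intF N : \int[leb n]_x F N x <= G%:R%:E * Y.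
  rewrite ge0_integral_sum//.
  apply: (@le_trans _ _ (\sum_(t : {ffun 'I_n -> bool}) Y)).
    by apply: lee_sum => t _; rewrite -integral_mkcond.
  by rewrite sumr_const mule_natl.
(* where the operator exceeds [lam], for large [N] some grid sum exceeds [lam']
   and [V N] is equal to the weight *)
have main : \int[leb n]_(x in [set x | lam%:E < `|multi_op phi f x|])
    (\prod_(i < m) u i x `^ m%:R^-1)%R%:E <= G%:R%:E * Y.
  apply: (@le_trans _ _ (\int[leb n]_x limn_einf (fun N => F N x))); last first.
    apply: (le_trans (fatou (leb n) measurableT mF (fun N x _ => F_ge0 N x))).
    exact: limn_einf_le.
  rewrite integral_mkcond; apply: (ae_le_lower_integral mZ) => //.
  - exact: measurable_fun_limn_einf.
  - by move=> x; apply: erestrict_ge0 => y _; rewrite lee_fin.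
  - by move=> x; apply: (limn_einf_ge (N0 := 0%N)) => N _.
  move=> x Zx; rewrite /patch; case: ifPn => [|_]; last first.
    by apply: (limn_einf_ge (N0 := 0%N)) => N _.
  rewrite inE /= => lamT.
  have [N1 hN1] := multi_op_eventually_lt n_gt0 m_gt0 phi_ge0 phi_loc C_gt0 phi_sup
    mg g_ge0 g_ae lamT.
  have /choice[N2 hN2] i := truncate_near (w i) x.
  apply: (limn_einf_ge (N0 := maxn N1 (\max_(i < m) N2 i))) => N.
  rewrite geq_max => /andP[/hN1 lamS /bigmax_leqP N2N].
  have [t Et] : exists t, E N t x.
    apply: contrapT => /forallNP nE; move: lamS; rewrite ltNge => /negP; apply.
    have : (S N x <= G%:R * lam')%R.
      rewrite /S mulr_natl -sumr_const; apply: ler_sum => t _.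
      by rewrite leNgt; apply/negP; exact: nE.
    rewrite -(ler_pM2l D_gt0) => /le_trans; apply.
    by rewrite mulrA /lam' mulrC divfK// gt_eqF// mulr_gt0.
  have -> : (\prod_(i < m) u i x `^ m%:R^-1)%R%:E = (V N x)%:E.
    congr EFin; apply: eq_bigr => i _; rewrite hN2 ?N2N//.
    by have [_ _ ->] := hNw i; [|move=> Nx; exact/Zx/(NwZ i)].
  rewrite /F (bigD1 t)//= {1}/patch mem_set// leeDl// sume_ge0//.
apply: (@le_trans _ _ (lam%:E * (G%:R%:E * Y) `^ m%:R)).
  apply: lee_wpmul2l; first by rewrite lee_fin ltW.
  have L0 : 0 <= \int[leb n]_(x in [set x | lam%:E < `|multi_op phi f x|])
    (\prod_(i < m) u i x `^ m%:R^-1)%R%:E by apply: integral_ge0 => x _; rewrite lee_fin.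
  apply: gt0_ler_poweR; [by []| | |exact: main].
    by rewrite in_itv/= leey L0.
  by rewrite in_itv/= leey andbT; exact: le_trans L0 main.
have lB0 : 0 <= (lam'^-1)%:E * (Cg%:E * B).
  by rewrite !mule_ge0// lee_fin ?invr_ge0 ltW.
rewrite poweRM ?lee_fin ?(ltW G_gt0)// /Y -poweRrM mulVf// poweRe1//.
rewrite poweR_EFin powR_mulrn ?(ltW G_gt0)// !muleA -!EFinM.
rewrite le_eqVlt; apply/orP; left; apply/eqP; congr (_%:E * _).
have : (0 < G%:R ^+ m :> R)%R by rewrite exprn_gt0.
move: (G%:R ^+ m)%R G_gt0 => q G0 q0; rewrite /lam'.
by field; rewrite !gt_eqF.
Qed.
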